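(* Let $A\in\mathcal{R}_1$, let $\mathcal{F}$ be a front on $[\emptyset,A]$, and let $\mathrm{R}$ be an equivalence relation on $\mathcal{F}$. Then there is $C\le A$ such that $\mathrm{R}$ restricted to $\mathcal{F}|C$ is canonical (as an equivalence relation on the front $\mathcal{F}|C$ on $[\emptyset,C]$); that is, there is an inner Sperner function $\varphi$ on $\mathcal{F}|C$ such that (1) for all $a,b\in\mathcal{F}|C$, $a\,\mathrm{R}\,b$ iff $\varphi(a)=\varphi(b)$, and (2) for every inner Sperner function $\varphi'$ on $\mathcal{F}|C$ satisfying (1) there is $Y\le C$ with $\varphi'(a)\subseteq\varphi(a)$ for all $a\in\mathcal{F}|Y$.
   Context: Let $\mathbb{T}=\{\langle\rangle\}\cup\{\langle n\rangle:n<\omega\}\cup\{\langle n,i\rangle:n<\omega,\ i\le n\}$. $X\subseteq\mathbb{T}$ is in $\mathcal{R}_1$ iff there are strictly increasing $(k_n)$ and $L_n\subseteq\{0,\dots,k_n\}$ with $|L_n|=n+1$ such that $X=\{\langle\rangle\}\cup\bigcup_n(\{\langle k_n\rangle\}\cup\{\langle k_n,i\rangle:i\in L_n\})$; $X(n)=\{\langle\rangle,\langle k_n\rangle,\langle k_n,i\rangle:i\in L_n\}$, $r_n(X)=\bigcup_{i<n}X(i)$ ($r_0(X)=\emptyset$), $\mathcal{AR}=\{r_n(X):X\in\mathcal{R}_1,n<\omega\}$. $Y\le X$ iff $Y\subseteq X$; for $a,b\in\mathcal{AR}$, $a\sqsubseteq b$ (resp. $a\sqsubseteq X$) means $a=r_m(b)$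 (resp. $a=r_m(X)$) for some $m$. A front on $[\emptyset,X]$ is a set $\mathcal{F}\subseteq\mathcal{AR}$ such that every $Y\le X$ has some $a\in\mathcal{F}$ with $a\sqsubseteq Y$, and $a\not\sqsubseteq b$ for all distinct $a,b\in\mathcal{F}$. For $X\in\mathcal{R}_1$, $\mathcal{F}|X=\{a\in\mathcal{F}:a\subseteq X\}$. A function $\varphi$ on $\mathcal{F}$ is inner if $\varphi(a)$ is a subtree of $a$ (a subset of $a$ closed under initial segments) for each $a\in\mathcal{F}$, and Sperner if $\varphi(a)$ is never a proper subset of $\varphi(b)$ for $a,b\in\mathcal{F}$. *)

(* Defs.v *)
From mathcomp Require Import all_boot finmap.
From mathcomp Require Import boolp classical_sets.

Set Implicit Arguments.
Unset Strict Implicit.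
Unset Printing Implicit Defensive.

Local Open Scope classical_set_scope.

(* Nodes are finite sequences of natural numbers; <n, i> is [:: n; i], and
   "initial segment" is seq's [prefix]. *)
Definition node := seq nat.

Definition TT : set node :=
  [set s | [\/ s = [::], exists n, s = [:: n]
             | exists n i, i <= n /\ s = [:: n; i]]].

Definition block (k : nat) (L : {fset nat}) : set node :=
  [set s | [\/ s = [::], s = [:: k] | exists2 i, i \in L & s = [:: k; i]]].

(* An element of R_1 is given by its sequences (k_n), (L_n); by [knum_tree] and
   [leaves_tree] below these are determined by the underlying subset of TT. *)
Record R1 := MkR1 {
  knum : nat -> nat;
  leaves : nat -> {fset nat};
  knum_incr : forall m n, m < n -> knum m < knum n;
  leaves_le : forall n i, i \in leaves n -> i <= knum n;
  leaves_card : forall n, #|` leaves n| = n.+1 }.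

Definition tree (X : R1) : set node :=
  [set [::]] `|`
  \bigcup_n ([set [:: knum X n]] `|` [set [:: knum X n; i] | i in [set` leaves X n]]).

Definition component (X : R1) (n : nat) : set node := block (knum X n) (leaves X n).

Definition approx (n : nat) (X : R1) : set node :=
  \bigcup_(i in [set i | i < n]) component X i.

Definition AR : set (set node) := [set a | exists X n, a = approx n X].

Definition leR1 (Y X : R1) : Prop := tree Y `<=` tree X.

Definition init_seg (a : set node) (X : R1) : Prop := exists m, a = approx m X.

(* For b = r_n(X) in AR, r_m(b) is r_m(X) with m <= n. *)
Definition init_segAR (a b : set node) : Prop :=
  exists (X : R1) (m n : nat), [/\ m <= n, a = approx m X & b = approx n X].

Definition front (X : R1) (F : set (set node)) : Prop :=
  [/\ F `<=` AR,
      forall Y, leR1 Y X -> exists2 a, F a & init_seg a Y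
    & forall a b, F a -> F b -> a <> b -> ~ init_segAR a b].

Definition restr (F : set (set node)) (X : R1) : set (set node) :=
  [set a | F a /\ a `<=` tree X].

Definition equivalence_on (F : set (set node)) (E : set node -> set node -> Prop) :
    Prop :=
  [/\ forall a, F a -> E a a,
      forall a b, F a -> F b -> E a b -> E b a
    & forall a b c, F a -> F b -> F c -> E a b -> E b c -> E a c].

Definition subtree (t a : set node) : Prop :=
  t `<=` a /\ forall s s' : node, prefix s s' -> t s' -> t s.

(* A function on F is a total function of which only the values on F are used. *)
Definition inner (F : set (set node)) (phi : set node -> set node) : Prop :=
  forall a, F a -> subtree (phi a) a.

Definition sperner (F : set (set node)) (phi : set node -> set node) : Prop :=
  forall a b, F a -> F b -> ~ (phi a `<` phi b).

Definition represents (F : set (set node)) (E : set node -> set node -> Prop)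
    (phi : set node -> set node) : Prop :=
  forall a b, F a -> F b -> (E a b <-> phi a = phi b).

Definition canonical_on (X : R1) (F : set (set node))
    (E : set node -> set node -> Prop) : Prop :=
  exists phi : set node -> set node,
    [/\ inner F phi, sperner F phi, represents F E phi
      & forall phi' : set node -> set node,
          inner F phi' -> sperner F phi' -> represents F E phi' ->
          exists2 Y, leR1 Y X & forall a, restr F Y a -> phi' a `<=` phi a].

Lemma tree_TT (X : R1) : tree X `<=` TT.
Proof.
move=> s [->|[n _ [->|[i /= iL <-]]]]; first exact: Or31.
  by apply: Or32; exists (knum X n).
by apply: Or33; exists (knum X n), i; split => //; exact: leaves_le.
Qed.

Lemma tree_components (X : R1) : tree X = \bigcup_n component X n.
Proof.
apply/seteqP; split => s.
  move=> [->|[n _ [->|[i /= iL <-]]]]; first by exists 0 => //; exact: Or31.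
    by exists n => //; exact: Or32.
  by exists n => //; apply: Or33; exists i.
move=> [n _ [->|->|[i iL ->]]]; first by left.
  by right; exists n => //; left.
by right; exists n => //; right; exists i.
Qed.

Lemma tree1P (X : R1) (k : nat) : tree X [:: k] <-> exists n, k = knum X n.
Proof.
split; first by move=> [//|[n _ [[->]|[i _ //]]]]; exists n.
by move=> [n ->]; right; exists n => //; left.
Qed.

Lemma knum_inj (X : R1) : injective (knum X).
Proof.
by move=> m n; case: (ltngtP m n) => // /(knum_incr X) + e; rewrite e ltnn.
Qed.

Lemma tree2P (X : R1) (n i : nat) : tree X [:: knum X n; i] <-> i \in leaves X n.
Proof.
split; last by move=> iL; right; exists n => //; right; exists i.
by move=> [//|[m _ [//|[j /= jL [/knum_inj <- <-]]]]].
Qed.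

Lemma knum_tree (X Y : R1) : tree X = tree Y -> knum X =1 knum Y.
Proof.
have H (A B : R1) n : tree A = tree B -> (forall m, m < n -> knum A m = knum B m) ->
    knum B n <= knum A n.
  move=> AB IH; have /tree1P [m Em] : tree B [:: knum A n].
    by rewrite -AB; apply/tree1P; exists n.
  rewrite Em; case: (ltngtP n m) => [/(knum_incr B)/ltnW//|mn|-> //].
  by move: Em; rewrite -IH // => /knum_inj En; rewrite En ltnn in mn.
move=> XY n; elim/ltn_ind: n => n IH.
apply/eqP; rewrite eqn_leq !H // => m mn; by rewrite IH.
Qed.

Lemma leaves_tree (X Y : R1) : tree X = tree Y -> leaves X =1 leaves Y.
Proof.
move=> XY n; apply/fsetP => i; apply/idP/idP => /tree2P.
  by rewrite XY (knum_tree XY) => /tree2P.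
by rewrite -XY -(knum_tree XY) => /tree2P.
Qed.

Lemma front_restr (A C : R1) (F : set (set node)) :
  leR1 C A -> front A F -> front C (restr F C).
Proof.
move=> CA [FAR Fcov FNW]; split; first by move=> a [/FAR].
  move=> Y YC; have [a Fa [m am]] := Fcov Y (fun s h => CA s (YC s h)).
  exists a; last by exists m.
  split=> // s; rewrite am => -[i _ si]; apply: YC.
  by rewrite tree_components; exists i.
by move=> a b [Fa _] [Fb _]; exact: FNW.
Qed.

(* Main.v *)
(* Idea. Fix a non-principal ultrafilter W on blocks (k, L) for which every property of the
   n-element subsets of L holds of all or of none of them, W-almost surely; the finite
   Ramsey theorem provides W. Call two approximations s, t mixed when W-generic
   extensions of s and t to members of the front can be equivalent: this is an
   equivalence relation, defined by recursion towards the front. For each s, either the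
   next block does not influence the mixing class of s (s is "constant"), or the class of
   s extended by the block (k, u) is determined exactly by k and the leaves of u at a
   fixed set of positions. These statements hold W-almost surely, so a fusion yields C
   where they always hold, and the canonical map collects the information read off at the
   nonconstant approximations. If B is sparse in C, every a in F|C whose image lies in B
   has a partner b in F|C with the same image and meeting B only in that image; this gives
   maximality, and together with the Nash-Williams theorem, by descent, the Sperner
   property. *)
Require Import Defs.
From mathcomp Require Import all_boot finmap zify.
From mathcomp Require Import boolp classical_sets filter.

Set Implicit Arguments.
Unset Strict Implicit.
Unset Printing Implicit Defensive.

Local Open Scope classical_set_scope.
Local Open Scope nat_scope.

(** * Increasing lists and their positions *)

(** The obstacle is that approximations [s], [t] of different lengths may both receive a block with
    the same number, with leaf lists [u], [v] that interleave in many ways, whereas [W] only decides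
    properties of single leaf lists of a fixed length. A pair is therefore coded as one list [z]
    read along two position lists, [u = sel z p] and [v = sel z q]. Mixing by a simultaneous
    extension asks for one such pattern only; the main work is to show that equality of the leaves
    at the read positions singles out all patterns that mix. Since [W] is an ultrafilter, failure of
    mixing is again a [W]-large statement; this makes mixing transitive and lets a single fusion
    settle all cases. Bar induction takes the place of ranks of fronts. Sperner and maximality need
    different members: the canonical map lives on one that is homogeneous for having a smaller image
    below, and a sparser one inside it witnesses maximality. *)

Definition sel (z p : seq nat) : seq nat := [seq nth 0 z i | i <- p].

(** Being a subsequence of [iota 0 N] packs order and bound into one boolean, and position lists
    compose by transitivity of [subseq]. *)
Definition positions (N : nat) (p : seq nat) : bool := subseq p (iota 0 N).

Lemma sorted_nth_ltn (z : seq nat) i j :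
  sorted ltn z -> i < j < size z -> nth 0 z i < nth 0 z j.
Proof.
move=> sz /andP[ij jz]; apply: (sorted_ltn_nth ltn_trans 0 sz) => //.
by rewrite inE (ltn_trans ij).
Qed.

Lemma nth_ltn_sorted (z : seq nat) :
  (forall i, i.+1 < size z -> nth 0 z i < nth 0 z i.+1) -> sorted ltn z.
Proof. by move=> H; apply/(sortedP 0) => i; exact: H. Qed.

Lemma sorted_nth_inj (z : seq nat) i j :
  sorted ltn z -> i < size z -> j < size z -> nth 0 z i = nth 0 z j -> i = j.
Proof.
move=> sz iz jz e; have H := @sorted_nth_ltn z.
case: (ltngtP i j) => // ij.
  by have := H i j sz; rewrite ij jz e ltnn => /(_ isT).
by have := H j i sz; rewrite ij iz e ltnn => /(_ isT).
Qed.

Lemma subset_subseq (u z : seq nat) :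
  sorted ltn u -> sorted ltn z -> {subset u <= z} -> subseq u z.
Proof.
move=> su sz uz.
suff -> : u = [seq x <- z | x \in u] by exact: filter_subseq.
apply: (irr_sorted_eq ltn_trans ltnn) => //.
  by apply: subseq_sorted (filter_subseq _ _) sz; exact: ltn_trans.
by move=> x; rewrite mem_filter; case xu: (x \in u) => //=; rewrite uz.
Qed.

Lemma subseq_ltn_sorted (u z : seq nat) : subseq u z -> sorted ltn z -> sorted ltn u.
Proof. by apply: subseq_sorted; exact: ltn_trans. Qed.

Lemma ltn_sorted_uniq (z : seq nat) : sorted ltn z -> uniq z.
Proof. by apply: sorted_uniq; [exact: ltn_trans | exact: ltnn]. Qed.

Lemma positionsP N p : reflect (sorted ltn p /\ forall i, i \in p -> i < N) (positions N p).
Proof.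
apply: (iffP idP) => [pN|[sp pN]].
  split; first exact: subseq_ltn_sorted pN (iota_ltn_sorted _ _).
  by move=> i /(mem_subseq pN); rewrite mem_iota.
apply: subset_subseq => //; first exact: iota_ltn_sorted.
by move=> i /pN; rewrite mem_iota.
Qed.

Lemma positions_nth N p i : positions N p -> i < size p -> nth 0 p i < N.
Proof. by case/positionsP => _ H ip; apply: H; exact: mem_nth. Qed.

Lemma size_sel z p : size (sel z p) = size p.
Proof. exact: size_map. Qed.

Lemma nth_sel z p i : i < size p -> nth 0 (sel z p) i = nth 0 z (nth 0 p i).
Proof. by move=> ip; rewrite (nth_map 0). Qed.

Lemma sel_sel z p q : positions (size p) q -> sel (sel z p) q = sel z (sel p q).
Proof.
case/positionsP => _ H; rewrite /sel -map_comp; apply/eq_in_map => i /H ip /=.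
by rewrite (nth_map 0).
Qed.

Lemma sel_subseq z p : positions (size z) p -> subseq (sel z p) z.
Proof.
by move=> /(map_subseq (nth 0 z)); rewrite -/(mkseq _ _) mkseq_nth.
Qed.

Lemma positions_sel N p q : positions N p -> positions (size p) q -> positions N (sel p q).
Proof. by move=> pN /sel_subseq H; exact: subseq_trans H pN. Qed.

Lemma sel_iota z : sel z (iota 0 (size z)) = z.
Proof. exact: mkseq_nth. Qed.

Lemma subseq_sel (z u : seq nat) :
  sorted ltn z -> subseq u z -> exists2 p, positions (size z) p & u = sel z p.
Proof.
move=> sz uz; exists [seq i <- iota 0 (size z) | nth 0 z i \in u].
  exact: filter_subseq.
apply: (irr_sorted_eq ltn_trans ltnn).
- exact: subseq_ltn_sorted uz sz.
- apply: subseq_ltn_sorted sz; apply: sel_subseq; exact: filter_subseq.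
- move=> x; apply/idP/mapP => [xu|[i]].
    have xz := mem_subseq uz xu; exists (index x z); last by rewrite nth_index.
    by rewrite mem_filter nth_index // xu mem_iota add0n index_mem.
  by rewrite mem_filter => /andP[? _] ->.
Qed.

Lemma sel_inj (z p q : seq nat) : sorted ltn z ->
  positions (size z) p -> positions (size z) q -> sel z p = sel z q -> p = q.
Proof.
move=> sz hp hq e; have es : size p = size q by rewrite -(size_sel z) e size_sel.
apply: (@eq_from_nth _ 0) => // i ip.
apply: (sorted_nth_inj sz); rewrite ?(positions_nth hp) ?(positions_nth hq) -?es //.
by rewrite -!nth_sel -?es // e.
Qed.

(* A pair (u, v) of subsets of l is z read along two position lists; only
   finitely many pairs of position lists occur when size u, size v are fixed. *)
Lemma pair_pattern (l u v : seq nat) : sorted ltn l -> subseq u l -> subseq v l ->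
  exists z p q, [/\ subseq z l, size z <= size u + size v, positions (size z) p,
     positions (size z) q & u = sel z p /\ v = sel z q].
Proof.
move=> sl ul vl; pose z := [seq x <- l | (x \in u) || (x \in v)].
have zl : subseq z l by exact: filter_subseq.
have sz := subseq_ltn_sorted zl sl.
have uz : subseq u z.
  apply: subset_subseq => //; first exact: subseq_ltn_sorted ul sl.
  by move=> x xu; rewrite mem_filter xu (mem_subseq ul).
have vz : subseq v z.
  apply: subset_subseq => //; first exact: subseq_ltn_sorted vl sl.
  by move=> x xv; rewrite mem_filter xv orbT (mem_subseq vl).
have [p hp ep] := subseq_sel sz uz; have [q hq eq] := subseq_sel sz vz.
exists z, p, q; split=> //.
rewrite -size_cat; apply: uniq_leq_size; first exact: ltn_sorted_uniq.
by move=> x; rewrite mem_filter mem_cat => /andP[].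
Qed.

(** Serves as a finite index list, so that finitely many cases can be met by one block. *)
Fixpoint sublists (l : seq nat) : seq (seq nat) :=
  if l is x :: l' then sublists l' ++ [seq x :: z | z <- sublists l'] else [:: [::]].

Lemma mem_sublists (l z : seq nat) : subseq z l -> z \in sublists l.
Proof.
elim: l z => [|x l IH] z; first by case: z.
case: z => [|y z] /=; first by move=> _; rewrite mem_cat IH // sub0seq.
rewrite mem_cat; case: eqP => [->|_] H; last by rewrite IH.
by apply/orP; right; apply: map_f; exact: IH.
Qed.

(* Sends the i-th element of q to the i-th element of beta and every other x into the gap
   that follows the image of the last element of q below x. *)
Definition stretch (q beta : seq nat) (x : nat) : nat :=
  nth 0 (0 :: beta) (count (fun i => i <= x) q) + (if x \in q then 0 else x.+1).

Lemma count_leq_nth (q : seq nat) i : sorted ltn q -> i < size q ->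
  count (fun j => j <= nth 0 q i) q = i.+1.
Proof.
move=> sq iq; rewrite -{2}(cat_take_drop i.+1 q) count_cat.
have -> : count (fun j => j <= nth 0 q i) (drop i.+1 q) = 0.
  apply/eqP; rewrite -leqn0 leqNgt -has_count; apply/hasPn => x /(nthP 0)[j].
  rewrite size_drop nth_drop => jd <-; rewrite -ltnNge.
  apply: sorted_nth_ltn => //; rewrite -ltn_subRL jd andbT; lia.
have /eqP -> : count (fun j => j <= nth 0 q i) (take i.+1 q) == size (take i.+1 q).
  rewrite -all_count; apply/allP => x /(nthP 0)[j].
  rewrite size_takel // => ji <-; rewrite nth_take //.
  case: (ltngtP j i) => [ji'|ij|->//]; last by lia.
  by apply: ltnW; apply: sorted_nth_ltn => //; lia.
by rewrite addn0 size_takel.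
Qed.

Lemma stretch_nth q beta i : sorted ltn q -> i < size q ->
  stretch q beta (nth 0 q i) = nth 0 beta i.
Proof. by move=> sq iq; rewrite /stretch count_leq_nth // mem_nth // addn0. Qed.

(** Between two entries of [q] the base value is fixed and [x.+1] is added to it; at an entry the
    base jumps by more than [N], which exceeds every added offset. The index 0 of [0 :: beta] covers
    what precedes the first entry. *)
Lemma stretch_mono (q beta : seq nat) N x y :
  (forall i j, i < j <= size q ->
     nth 0 (0 :: beta) i + N < nth 0 (0 :: beta) j) ->
  x < y < N -> stretch q beta x < stretch q beta y.
Proof.
move=> hb /andP[xy yN]; rewrite /stretch.
set cx := count _ q; set cy := count _ q.
have cxy : cx <= cy by apply: sub_count => i /= ix; lia.
case: (ltngtP cx cy) => [cc|cc|cc]; last first.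
- have yq : y \notin q.
    apply/negP => yq; move: cc; apply/eqP; rewrite neq_ltn; apply/orP; left.
    rewrite /cx /cy -[X in X < _]addn0.
    have -> : count (fun i => i <= y) q = count (fun i => i <= x) q
        + count (fun i => x < i <= y) q.
      rewrite -count_predUI; set c0 := count (predI _ _) q.
      have -> : c0 = 0.
        by apply/eqP; rewrite -leqn0 leqNgt -has_count; apply/hasPn => i _ /=; lia.
      by rewrite addn0; apply: eq_count => i /=; lia.
    rewrite ltn_add2l -has_count; apply/hasP; exists y => //; lia.
  by rewrite cc (negbTE yq); case: (x \in q); lia.
- lia.
- have := hb cx cy; rewrite cc count_size => /(_ isT).
  by case: (x \in q); case: (y \in q); lia.
Qed.

Lemma stretch_sorted (q beta : seq nat) N :
  (forall i j, i < j <= size q ->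
     nth 0 (0 :: beta) i + N < nth 0 (0 :: beta) j) ->
  sorted ltn [seq stretch q beta x | x <- iota 0 N].
Proof.
move=> hb; apply: nth_ltn_sorted => i; rewrite size_map size_iota => iN.
rewrite !(nth_map 0) ?size_iota ?nth_iota //; try lia.
by apply: stretch_mono hb _; lia.
Qed.

Lemma sel_stretch (q beta : seq nat) N : positions N q -> size beta = size q ->
  sel [seq stretch q beta x | x <- iota 0 N] q = beta.
Proof.
move=> hq sb; apply: (@eq_from_nth _ 0); first by rewrite size_sel.
move=> i; rewrite size_sel => iq; have iN := positions_nth hq iq.
rewrite nth_sel // (nth_map 0) ?size_iota // nth_iota // add0n stretch_nth //.
by case/positionsP: hq.
Qed.

(** Two patterns are glued along a common part: this part goes to multiples of [B], and [B] is large
    enough for the remaining points of either side to fit into the gaps. It is used to compose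
    mixing patterns and to compare two of them. *)
Lemma amalgam (N M : nat) (p q : seq nat) :
  positions N p -> positions M q -> size p = size q ->
  exists K e e', [/\ positions K e, positions K e', size e = N, size e' = M
    & sel e p = sel e' q].
Proof.
move=> hp hq pq; pose B := (N + M).+1.
pose beta := [seq i.+1 * B | i <- iota 0 (size p)].
have sb : size beta = size p by rewrite size_map size_iota.
have nb i : i <= size p -> nth 0 (0 :: beta) i = i * B.
  case: i => [|i] ip //=; rewrite (nth_map 0) ?size_iota // nth_iota //.
have hb r L i j : size r = size p -> L <= N + M -> i < j <= size r ->
    nth 0 (0 :: beta) i + L < nth 0 (0 :: beta) j.
  move=> er LNM /andP[ij jp]; rewrite !nb; try lia.
  have : i.+1 * B <= j * B by rewrite leq_mul2r ij orbT.
  by rewrite mulSn /B; lia.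
pose e := [seq stretch p beta x | x <- iota 0 N].
pose e' := [seq stretch q beta x | x <- iota 0 M].
pose K := (\max_(i <- e ++ e') i).+1.
have hK i : i \in e ++ e' -> i < K by move=> ie; rewrite ltnS; exact: leq_bigmax_seq.
exists K, e, e'; split; rewrite ?size_map ?size_iota //.
- apply/positionsP; split; first by apply: stretch_sorted => i j; apply: hb => //; lia.
  by move=> i ie; apply: hK; rewrite mem_cat ie.
- apply/positionsP; split; first by apply: stretch_sorted => i j; apply: hb => //; lia.
  by move=> i ie; apply: hK; rewrite mem_cat ie orbT.
- by rewrite !sel_stretch ?sb.
Qed.

(** [l2] consists of the elements of [l] at positive multiples of [B]. Stretching puts [w] on such
    multiples and every other element of [v] at an offset between 1 and [n0.+1], hence never into
    [l2]. The factor [i.+2] leaves one gap before the first chosen element and one after the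
    last. *)
Lemma spaced_sublist (l : seq nat) (i n0 : nat) : sorted ltn l ->
  i.+2 * n0.+2 <= size l ->
  exists l2, [/\ subseq l2 l, size l2 = i.+1 &
    forall w J n, n <= n0.+1 -> positions n J -> subseq w l2 -> size w = size J ->
    exists v, [/\ subseq v l, size v = n, sel v J = w &
       forall x, x \in v -> x \in l2 -> x \in w]].
Proof.
move=> sl lbig; pose B := n0.+2.
pose P := [seq j.+1 * B | j <- iota 0 i.+1].
have sP : size P = i.+1 by rewrite size_map size_iota.
have nP j : j < i.+1 -> nth 0 P j = j.+1 * B.
  by move=> ji; rewrite (nth_map 0) ?size_iota // nth_iota.
have hP : positions (size l) P.
  apply/positionsP; split.
    by apply: nth_ltn_sorted => j; rewrite sP => ji; rewrite !nP; nia.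
  by move=> x /mapP[j]; rewrite mem_iota => ji ->; nia.
have Pl := sel_subseq hP; have sPl := subseq_ltn_sorted Pl sl.
exists (sel l P); split=> //; first by rewrite size_sel.
move=> w J n nn0 hJ wP wJ.
have [r hr ew] := subseq_sel sPl wP; rewrite size_sel in hr.
have sr : size r = size J by rewrite -wJ ew size_sel.
pose beta := sel P r; have sb : size beta = size J by rewrite size_sel.
have nb j : j < size r -> nth 0 beta j = (nth 0 r j).+1 * B.
  by move=> jr; rewrite nth_sel // nP // -sP; exact: positions_nth hr jr.
have hb a b : a < b <= size J ->
    nth 0 (0 :: beta) a + n < nth 0 (0 :: beta) b.
  case: b => [//|b] /andP[ab bJ]; rewrite /= nb ?sr //.
  case: a ab => [|a] ab /=; first by nia.
  rewrite nb ?sr; last by lia.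
  have : nth 0 r a < nth 0 r b.
    by apply: sorted_nth_ltn; [case/positionsP: hr | rewrite sr; lia].
  by rewrite /B; nia.
pose e := [seq stretch J beta x | x <- iota 0 n].
have he : positions (size l) e.
  apply/positionsP; split; first exact: stretch_sorted.
  move=> x /mapP[y]; rewrite mem_iota => yn ->; rewrite /stretch.
  set c := count _ _; have cJ : c <= size J by exact: count_size.
  have : nth 0 (0 :: beta) c <= i.+1 * B.
    case: c cJ => [//|c] cJ /=; rewrite nb ?sr //.
    have : nth 0 r c < size P by apply: positions_nth hr _; rewrite sr.
    by rewrite sP => ?; rewrite leq_mul2r; lia.
  by case: ifP => _; rewrite /B; nia.
exists (sel l e); split.
- exact: sel_subseq.
- by rewrite size_sel size_map size_iota.
- rewrite sel_sel; last by rewrite size_map size_iota.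
  by rewrite sel_stretch // ew sel_sel.
- move=> x /mapP[y /mapP[j]]; rewrite mem_iota => jn -> -> /mapP[y' y'P] e'.
  have ylt : stretch J beta j < size l.
    by case/positionsP: he => _; apply; apply: map_f; rewrite mem_iota.
  have y'lt : y' < size l by case/positionsP: hP => _; apply.
  have := sorted_nth_inj sl ylt y'lt e'.
  case/mapP: y'P => m; rewrite mem_iota => mi ey'.
  have [jJ _|jJ] := boolP (j \in J).
    rewrite ew; have /(nthP 0) [a aJ ea] := jJ.
    rewrite -ea stretch_nth //; last by case/positionsP: hJ.
    rewrite nth_sel ?sr // -nth_sel; last by apply: positions_nth hr _; rewrite sr.
    by apply: map_f; apply: mem_nth; rewrite sr.
  rewrite ey' /stretch (negbTE jJ); set c := count _ _.
  have cJ : c <= size J by exact: count_size.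
  have [d ->] : exists d, nth 0 (0 :: beta) c = d * B.
    case: c cJ => [|c] cJ; first by exists 0.
    by exists (nth 0 r c).+1; rewrite /= nb ?sr.
  move=> /(congr1 (modn^~ B)); rewrite modnMDl modnMl modn_small // /B; lia.
Qed.

(** * Finite Ramsey theorem for increasing lists *)

Definition homog (N : nat) (P : seq nat -> Prop) (l : seq nat) : Prop :=
  (forall z, subseq z l -> size z = N -> P z) \/
  (forall z, subseq z l -> size z = N -> ~ P z).

(** End-homogeneity, the usual halfway stage of Ramsey's theorem: the colour of an [N.+1]-element
    list depends on its first element only, and [c] records these colours. *)
Fixpoint prehomog (N : nat) (P : seq nat -> Prop) (c : seq bool) (l : seq nat) : Prop :=
  match c, l with
  | [::], [::] => True
  | b :: c', x :: l' =>
      (forall z, subseq z l' -> size z = N -> (P (x :: z) <-> b)) /\ prehomog N P c' l'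
  | _, _ => False
  end.

Lemma prehomog_size N P c l : prehomog N P c l -> size c = size l.
Proof. by elim: c l => [|b c IH] [|x l] //= [_ /IH ->]. Qed.

Lemma prehomog_mask N P c l b : prehomog N P c l ->
  forall z, subseq z (mask [seq x == b | x <- c] l) -> size z = N.+1 -> (P z <-> b).
Proof.
elim: c l => [|b' c IH] [|x l] //=; first by move=> _ z /eqP ->.
move=> [H1 H2] z; have [e|_] := eqVneq b' b; [subst b' | exact: IH].
case: z => [|y z] //=; case: eqP => [->|_] hz [sz].
  by apply: H1 => //; exact: subseq_trans hz (mask_subseq _ _).
by apply: (IH l H2 _ hz); rewrite /= sz.
Qed.

(** The bound comes before [P], because it is applied to properties that depend on the number of a
    block which is itself chosen by its size. *)
Lemma finite_ramsey N m : exists M, forall (P : seq nat -> Prop) l, M <= size l ->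
  exists2 l', subseq l' l & size l' = m /\ homog N P l'.
Proof.
elim: N m => [|N IHN] m.
  exists m => P l ml; exists (take m l); first exact: take_subseq.
  rewrite size_takel //; split=> //.
  have [p|np] := pselect (P [::]); [left|right] => z _ /size0nil -> //.
(* [m.*2] points suffice, since one of the two recorded colours then occurs at least [m] times. *)
have [M hM] : exists M, forall (P : seq nat -> Prop) l, M <= size l ->
    exists l' c, [/\ subseq l' l, size l' = m.*2 & prehomog N P c l'].
  elim: m.*2 => [|k [M1 hM1]].
    by exists 0 => P l _; exists [::], [::]; split=> //; exact: sub0seq.
  have [M2 hM2] := IHN M1; exists M2.+1 => P [//|x l] Ml.
  have [l1 l1l [sl1 hl1]] := hM2 (fun z => P (x :: z)) l Ml.
  have [l2 [c [l2l1 sl2 hl2]]] := hM1 P l1 (eq_leq (esym sl1)).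
  have l2l := subseq_trans l2l1 l1l.
  case: hl1 => hl1.
    exists (x :: l2), (true :: c); split; rewrite /= ?eqxx ?sl2 //; split=> //.
    by move=> z zl2 sz; split=> // _; apply: hl1 => //; exact: subseq_trans zl2 l2l1.
  exists (x :: l2), (false :: c); split; rewrite /= ?eqxx ?sl2 //; split=> //.
  by move=> z zl2 sz; split=> // pz; case: (hl1 z _ sz pz); exact: subseq_trans zl2 l2l1.
exists M => P l /(hM P) [l' [c [l'l sl' hl']]].
have sc := prehomog_size hl'.
have [b hb] : exists b, m <= count (fun x => x == b) c.
  have := count_predC (fun x => x == true) c.
  rewrite sc sl' => hc.
  have [h|h] := leqP m (count (fun x => x == true) c); first by exists true.
  exists false; have <- : count (predC (fun x => x == true)) c
      = count (fun x => x == false) c by apply: eq_count => -[].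
  lia.
pose l2 := mask [seq x == b | x <- c] l'.
have sl2 : size l2 = count (fun x => x == b) c.
  by rewrite size_mask ?size_map // count_map; apply: eq_count.
exists (take m l2).
  apply: subseq_trans (take_subseq _ _) _; apply: subseq_trans l'l.
  exact: mask_subseq.
split; first by rewrite size_takel // sl2.
have H z : subseq z (take m l2) -> size z = N.+1 -> (P z <-> b).
  move=> hz; apply: prehomog_mask hl' _ _.
  exact: subseq_trans hz (take_subseq _ _).
by case: b @l2 hb sl2 H => l2 _ _ H; [left|right] => z hz sz; [apply/(H z hz sz)|move/(H z hz sz)].
Qed.

(** * Members of R_1 and finite approximations as lists of blocks *)

Definition blk : eqType := (nat * seq nat)%type.

Definition leaf_list (X : R1) (m : nat) : seq nat := sort leq (enum_fset (leaves X m)).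

Lemma mem_leaf_list X m i : (i \in leaf_list X m) = (i \in leaves X m).
Proof. by rewrite mem_sort. Qed.

Lemma leaf_list_sorted X m : sorted ltn (leaf_list X m).
Proof.
rewrite ltn_sorted_uniq_leq sort_uniq fset_uniq /=.
by apply: sort_sorted; exact: leq_total.
Qed.

Lemma size_leaf_list X m : size (leaf_list X m) = m.+1.
Proof. by rewrite size_sort -[RHS](leaves_card X). Qed.

Lemma leaf_list_le X m i : i \in leaf_list X m -> i <= knum X m.
Proof. by rewrite mem_leaf_list; exact: leaves_le. Qed.

Lemma knum_lt X m n : knum X m < knum X n -> m < n.
Proof.
by move=> H; rewrite ltnNge; apply/negP; rewrite leq_eqVlt => /predU1P[e|/(knum_incr X)];
  [rewrite e in H|]; lia.
Qed.

Lemma knum_ge X m : m <= knum X m.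
Proof. by elim: m => // m IH; have := knum_incr X (ltnSn m); lia. Qed.

(** The number of leaves is left free, so that the truncated blocks of the canonical image are
    subblocks too. *)
Definition subblock (X : R1) (b : blk) : Prop :=
  exists2 m, b.1 = knum X m & subseq b.2 (leaf_list X m).

Lemma subblock_sorted X b : subblock X b -> sorted ltn b.2.
Proof. by case=> m _ H; exact: subseq_ltn_sorted H (leaf_list_sorted _ _). Qed.

Lemma subblock_sub X (b : blk) l : subblock X b -> subseq l b.2 -> subblock X (b.1, l).
Proof. by case=> m e H lb; exists m => //; exact: subseq_trans lb H. Qed.

Lemma subblock_block X m : subblock X (knum X m, leaf_list X m).
Proof. by exists m. Qed.

Lemma leR1P Y X : leR1 Y X <-> forall m, subblock X (knum Y m, leaf_list Y m).
Proof.
split=> [YX m|H s].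
  have /tree1P[n kn] : tree X [:: knum Y m] by apply: YX; apply/tree1P; exists m.
  exists n => //=; apply: subset_subseq; rewrite ?leaf_list_sorted //.
  move=> i; rewrite !mem_leaf_list => /tree2P /YX; rewrite kn.
  by move/tree2P.
case=> [->|[m _ [->|[i /= iL <-]]]]; first by left.
  by have [n /= -> _] := H m; apply/tree1P; exists n.
have [n /= -> sub] := H m; apply/tree2P; rewrite -mem_leaf_list.
by apply: (mem_subseq sub); rewrite mem_leaf_list.
Qed.

Lemma subblock_le Y X b : leR1 Y X -> subblock Y b -> subblock X b.
Proof.
move=> /leR1P YX [m e H]; have [n /= e' H'] := YX m; exists n; first by rewrite e.
exact: subseq_trans H H'.
Qed.

Lemma leR1_trans Z Y X : leR1 Z Y -> leR1 Y X -> leR1 Z X.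
Proof. by move=> ZY YX s /ZY /YX. Qed.

Lemma R1_of_blocks X (f : nat -> blk) :
  (forall m, (f m).1 < (f m.+1).1) -> (forall m, size (f m).2 = m.+1) ->
  (forall m, subblock X (f m)) ->
  exists2 Y, leR1 Y X & forall m, knum Y m = (f m).1 /\ leaf_list Y m = (f m).2.
Proof.
move=> f1 f2 f3.
have incr m n : m < n -> (f m).1 < (f n).1.
  exact: (@homo_ltn _ (fun m => (f m).1) (fun a b => a < b) (fun y x z => @ltn_trans y x z) f1).
pose L m : {fset nat} := [fset i in (f m).2]%fset.
have mL m i : (i \in L m) = (i \in (f m).2) by rewrite inE.
have Lle m i : i \in L m -> i <= (f m).1.
  by rewrite mL; case: (f3 m) => n -> H /(mem_subseq H); exact: leaf_list_le.
have srt m : sorted ltn (f m).2 by exact: subblock_sorted (f3 m).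
have Lc m : #|` L m| = m.+1.
  rewrite -f2 card_fseq undup_id //; exact: ltn_sorted_uniq.
pose Y := MkR1 incr Lle Lc.
have H m : knum Y m = (f m).1 /\ leaf_list Y m = (f m).2.
  split=> //; apply: (irr_sorted_eq ltn_trans ltnn); rewrite ?leaf_list_sorted ?srt //.
  by move=> i; rewrite mem_leaf_list mL.
exists Y => //; apply/leR1P => m; have [-> ->] := H m.
by rewrite -surjective_pairing.
Qed.

(** These are the approximations of members below [X], not only of [X] itself; [is_approx_extend]
    makes this precise. *)
Definition is_approx (X : R1) (s : seq blk) : Prop :=
  [/\ sorted ltn (unzip1 s), [seq size b.2 | b <- s] = iota 1 (size s)
    & forall b, b \in s -> subblock X b].

Definition below (K : nat) (s : seq blk) : bool := all (fun c => c.1 < K) s.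

Lemma below_rcons K s (b : blk) : below K (rcons s b) = (b.1 < K) && below K s.
Proof. exact: all_rcons. Qed.

Lemma below_leq K K' s : K <= K' -> below K s -> below K' s.
Proof. by move=> KK; apply: sub_all => c /= h; exact: leq_trans h KK. Qed.

Lemma is_approx0 X : is_approx X [::].
Proof. by []. Qed.

Lemma is_approx_rcons X s (b : blk) : is_approx X (rcons s b) <->
  [/\ is_approx X s, subblock X b, size b.2 = (size s).+1 & below b.1 s].
Proof.
rewrite /is_approx /unzip1 !map_rcons !size_rcons !(sorted_pairwise ltn_trans) pairwise_rcons.
have -> : iota 1 (size s).+1 = rcons (iota 1 (size s)) (size s).+1.
  by rewrite -cats1 -[in LHS](addn1 (size s)) iotaD.
have -> : all (ltn^~ b.1) [seq i.1 | i <- s] = below b.1 s by rewrite all_map.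
split.
  move=> [/andP[h1 h2] /eqP]; rewrite eqseq_rcons => /andP[/eqP h3 /eqP h4] h5.
  split=> //; last by apply: h5; rewrite mem_rcons mem_head.
  by split=> // c cs; apply: h5; rewrite mem_rcons inE cs orbT.
move=> [[h1 h2 h3] h4 h5 h6]; split; first by rewrite h6.
  by rewrite h2 h5.
by move=> c; rewrite mem_rcons inE => /predU1P[->|/h3].
Qed.

Lemma is_approx_take X s n : is_approx X s -> is_approx X (take n s).
Proof.
elim/last_ind: s => [//|s b IH] /[dup] H /is_approx_rcons[hs _ _ _].
have [h|h] := leqP (size (rcons s b)) n; first by rewrite take_oversize.
rewrite size_rcons in h.
by rewrite -cats1 takel_cat; [exact: IH | lia].
Qed.

Lemma is_approx_le Y X s : leR1 Y X -> is_approx Y s -> is_approx X s.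
Proof. by move=> YX [h1 h2 h3]; split=> // b /h3; exact: subblock_le. Qed.

(** An overestimate that checks neither the sizes of leaf lists nor membership in [X]; fusion relies
    on its finiteness. *)
Fixpoint approxes_below (K : nat) : seq (seq blk) :=
  if K is K'.+1 then
    approxes_below K' ++ [seq rcons s (K', u) | s <- approxes_below K', u <- sublists (iota 0 K)]
  else [:: [::]].

Lemma mem_approxes_below X K s : is_approx X s -> below K s -> s \in approxes_below K.
Proof.
elim: K s => [|K IH] s; first by case: s.
case/lastP: s => [_ _|s b]; first by rewrite mem_cat IH.
move=> /[dup] aps /is_approx_rcons[hs hb _ sb]; rewrite below_rcons => /andP[bK _].
rewrite mem_cat; case: (ltngtP b.1 K) => [bK'|bK'|bK'].
- by rewrite IH // below_rcons bK' (below_leq (ltnW bK')).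
- by lia.
- have -> : b = (K, b.2) by rewrite -bK' -surjective_pairing.
  apply/orP; right; apply: allpairs_f; first by apply: IH => //; rewrite -bK'.
  apply: mem_sublists; apply/positionsP; split; first exact: subblock_sorted hb.
  by case: hb => m e sub i /(mem_subseq sub) /leaf_list_le; rewrite -e; lia.
Qed.

Definition approx_list (Y : R1) (n : nat) : seq blk :=
  [seq (knum Y i, leaf_list Y i) : blk | i <- iota 0 n].

Lemma approx_listS Y n : approx_list Y n.+1 = rcons (approx_list Y n) (knum Y n, leaf_list Y n).
Proof. by rewrite /approx_list -addn1 iotaD map_cat cats1. Qed.

Lemma size_approx_list Y n : size (approx_list Y n) = n.
Proof. by rewrite size_map size_iota. Qed.

Lemma below_approx_list Y n : below (knum Y n) (approx_list Y n).
Proof. by apply/allP => b /mapP[i]; rewrite mem_iota => /andP[_ h] -> /=; exact: knum_incr. Qed.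

Lemma is_approx_approx_list Y n : is_approx Y (approx_list Y n).
Proof.
elim: n => [|n IH]; first exact: is_approx0.
rewrite approx_listS; apply/is_approx_rcons; split=> //=; first exact: subblock_block.
  by rewrite size_leaf_list size_approx_list.
exact: below_approx_list.
Qed.

(** * Fronts on lists of blocks and bar induction *)

Definition live (F : seq blk -> Prop) (s : seq blk) : Prop :=
  forall n, n < size s -> ~ F (take n s).

Lemma live_rcons F s b : live F (rcons s b) <-> live F s /\ ~ F s.
Proof.
split=> [H|[H Fs] n].
  split; last by have := H (size s); rewrite size_rcons -cats1 take_size_cat // => /(_ (ltnSn _)).
  move=> n ns; have := H n; rewrite size_rcons -cats1 takel_cat; last exact: ltnW.
  by apply; lia.
rewrite size_rcons ltnS -cats1 => ns; rewrite takel_cat //.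
by move: ns; rewrite leq_eqVlt => /predU1P[->|/H//]; rewrite take_size.
Qed.

Definition lfront (X : R1) (F : seq blk -> Prop) : Prop :=
  (forall Y, leR1 Y X -> exists n, F (approx_list Y n)) /\
  (forall s, is_approx X s -> F s -> live F s).

Lemma lfront_le Y X F : leR1 Y X -> lfront X F -> lfront Y F.
Proof.
move=> YX [h1 h2]; split=> [Z ZY|s /(is_approx_le YX)]; last exact: h2.
by apply: h1; exact: leR1_trans YX.
Qed.

(** Well-foundedness of the tree of approximations that have not yet met the front, in a form to
    induct on. *)
Inductive barred (X : R1) (F : seq blk -> Prop) (s : seq blk) : Prop :=
| barred_leaf : F s -> barred X F s
| barred_node : (forall b, is_approx X (rcons s b) -> barred X F (rcons s b)) -> barred X F s.

(** Otherwise extensions that are not barred can be chosen forever, and together they form a member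
    below [X] without initial segment in [F]. *)
Lemma lfront_barred0 X F : lfront X F -> barred X F [::].
Proof.
move=> [cov _]; apply: contrapT => nb.
have /choice [f hf] : forall s, exists b : blk, is_approx X s -> ~ barred X F s ->
    is_approx X (rcons s b) /\ ~ barred X F (rcons s b).
  move=> s; have [[h1 h2]|h] := pselect (is_approx X s /\ ~ barred X F s); last first.
    by exists (0, [::]) => h1 h2; case: h.
  apply: contrapT => nex; apply: h2; apply: barred_node => b apb.
  by apply: contrapT => nbb; apply: nex; exists b.
pose fix g n : seq blk := if n is m.+1 then rcons (g m) (f (g m)) else [::].
have hg n : is_approx X (g n) /\ ~ barred X F (g n).
  elim: n => [|n [h1 h2]]; first by split=> //; exact: is_approx0.
  exact: hf.
have sg n : size (g n) = n by elim: n => //= n IH; rewrite size_rcons IH.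
have hg' n := (is_approx_rcons _ _ _).1 (hg n.+1).1.
have [Y YX hY] := @R1_of_blocks X (fun n => f (g n))
  (fun n => ltac:(by have [_ _ _] := hg' n.+1; rewrite /= below_rcons => /andP[]))
  (fun n => ltac:(by have [_ _ + _] := hg' n; rewrite sg))
  (fun n => ltac:(by have [_ h _ _] := hg' n; exact: h)).
have [n] := cov Y YX.
have -> : approx_list Y n = g n.
  elim: n => //= n IH; rewrite approx_listS IH; have [-> ->] := hY n.
  by rewrite -surjective_pairing.
by move=> /(@barred_leaf X F); have [] := hg n.
Qed.

Lemma lfront_barred X F s : lfront X F -> is_approx X s -> live F s -> barred X F s.
Proof.
move=> hF; elim/last_ind: s => [|s b IH] aps; first by move=> _; exact: lfront_barred0.
move=> /live_rcons[ls nFs]; have [aps0 _ _ _] := (is_approx_rcons _ _ _).1 aps.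
by have [//|h] := IH aps0 ls; exact: h.
Qed.

(** * An ultrafilter of blocks *)

Definition block_ultra (X : R1) (W : set_system blk) : Prop :=
  [/\ UltraFilter W, W [set b | subblock X b],
      forall n, W [set b : blk | n <= b.1 /\ n <= size b.2]
    & forall N (P : nat -> seq nat -> Prop),
      W [set b : blk | forall z, subseq z b.2 -> size z = N -> P b.1 z] \/
      W [set b : blk | forall z, subseq z b.2 -> size z = N -> ~ P b.1 z]].

Definition homogs (Ps : seq (nat * (nat -> seq nat -> Prop))) (b : blk) : Prop :=
  forall i, i < size Ps ->
    homog (nth (0, fun _ _ => True) Ps i).1 ((nth (0, fun _ _ => True) Ps i).2 b.1) b.2.

Lemma homog_sub N P l l' : subseq l l' -> homog N P l' -> homog N P l.
Proof. by move=> ll [h|h]; [left|right] => z zl; apply: h; exact: subseq_trans zl ll. Qed.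

(** The finite intersection property of the sets that generate [W]. The colourings are treated one
    after another, and the bounds are computed backwards: [M2] points leave [M1] after the tail
    [Ps], enough for the first colouring. *)
Lemma homogs_ex X n Ps : exists b : blk,
  [/\ subblock X b, n <= b.1, n <= size b.2 & homogs Ps b].
Proof.
suff [M hM] : exists M, forall k l, M <= size l -> exists2 l', subseq l' l &
    size l' = n /\ homogs Ps (k, l').
  have [|l' sub [sl hl]] := hM (knum X (M + n)) (leaf_list X (M + n)).
    by rewrite size_leaf_list; lia.
  exists (knum X (M + n), l'); split=> //=; first by exists (M + n).
    by have := knum_ge X (M + n); lia.
  by rewrite sl.
elim: Ps n => [|[N P] Ps IH] n.
  exists n => k l nl; exists (take n l); first exact: take_subseq.
  by rewrite size_takel.
have [M1 hM1] := finite_ramsey N n; have [M2 hM2] := IH M1.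
exists M2 => k l /(hM2 k)[l1 l1l [sl1 hl1]].
have [l2 l2l1 [sl2 hl2]] := hM1 (P k) l1 (eq_leq (esym sl1)).
exists l2; first exact: subseq_trans l2l1 l1l.
split=> // -[|i] //= iP; apply: homog_sub l2l1 _; exact: hl1.
Qed.

Lemma homogs_cat Ps Ps' b : homogs (Ps ++ Ps') b -> homogs Ps b /\ homogs Ps' b.
Proof.
move=> h; split=> i iP.
  by have := h i; rewrite size_cat nth_cat iP; apply; lia.
have := h (size Ps + i); rewrite size_cat nth_cat ltn_add2l iP => /(_ isT).
by rewrite ltnNge leq_addr addKn.
Qed.

Lemma block_ultra_ex X : exists W, block_ultra X W.
Proof.
pose B : set_system blk := [set S | exists n Ps, forall b,
  subblock X b -> n <= b.1 -> n <= size b.2 -> homogs Ps b -> S b].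
have BF : ProperFilter B.
  apply: Build_ProperFilter_ex.
    move=> S [n [Ps H]]; have [b [h1 h2 h3 h4]] := homogs_ex X n Ps.
    by exists b; exact: H.
  split.
  - by exists 0, [::].
  - move=> S S' [n [Ps H]] [n' [Ps' H']]; exists (n + n'), (Ps ++ Ps').
    by move=> b h1 h2 h3 /homogs_cat[h4 h5]; split; [apply: H|apply: H'] => //; lia.
  - by move=> S S' SS' [n [Ps H]]; exists n, Ps => b *; apply: SS'; exact: H.
have [W [WU BW]] := ultraFilterLemma BF.
have WF : Filter W by exact: filter_filter.
exists W; split=> //; first by apply: BW; exists 0, [::].
  by move=> n; apply: BW; exists n, [::].
move=> N P.
(* If almost no block satisfies [P] on all its [N]-element sublists, homogeneity leaves only the
   blocks on which [P] always fails. *)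
set S := [set b : blk | _]; have [h|h] := in_ultra_setVsetC S WU; first by left.
have hom : W [set b : blk | homog N (P b.1) b.2].
  apply: BW; exists 0, [:: (N, P)] => b _ _ _; exact: (fun H => H 0 isT).
right; apply: filterS (filterI h hom) => b [h1 [h2|//]].
by case: h1.
Qed.

Lemma ultraI (T : Type) (W : set_system T) (WU : UltraFilter W) (P Q : set T) :
  W P -> W Q -> W [set x | P x /\ Q x].
Proof. by move=> WP WQ; exact: (@filterI _ W (@filter_filter _ W _)). Qed.

Lemma ultraS (T : Type) (W : set_system T) (WU : UltraFilter W) (P Q : set T) :
  W P -> (forall x, P x -> Q x) -> W Q.
Proof. by move=> WP PQ; apply: (@filterS _ W (@filter_filter _ W _)) WP. Qed.

Lemma ultra_ex (T : Type) (W : set_system T) (WU : UltraFilter W) (P : set T) :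
  W P -> exists x, P x.
Proof. exact: filter_ex. Qed.

Lemma filter_allseq (T : Type) (I : eqType) (W : set_system T) (WF : Filter W) (r : seq I)
    (G : I -> set T) :
  (forall i, i \in r -> W (G i)) -> W [set x | forall i, i \in r -> G i x].
Proof.
elim: r => [|i r IH] H; first by apply: filterS filterT.
have h1 := H i (mem_head _ _).
have h2 : W [set x | forall i, i \in r -> G i x].
  by apply: IH => j jr; apply: H; rewrite inE jr orbT.
apply: filterS (filterI h1 h2) => x [g1 g2] j.
by rewrite inE => /predU1P[->|/g2].
Qed.

(** Diagonalisation: each block of [Y] is chosen good for the finitely many pairs of approximations
    below it. Only [m.+1] leaves of the good block are kept, and [G] need not be inherited by fewer
    leaves, so the conclusion speaks of a longer list [l]. *)
Lemma fusion X W (G : seq blk -> seq blk -> set blk) : block_ultra X W ->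
  (forall s t, is_approx X s -> is_approx X t -> W (G s t)) ->
  exists2 Y, leR1 Y X & forall s t b, is_approx Y s -> is_approx Y t -> subblock Y b ->
    below b.1 s -> below b.1 t -> exists2 l, subseq b.2 l & subblock X (b.1, l) /\ G s t (b.1, l).
Proof.
move=> [WU WX Wn _] HG; have WF : Filter W by exact: filter_filter.
have /choice [f hf] : forall a : nat * nat, exists b : blk,
    [/\ subblock X b, a.2 <= b.1, size b.2 = a.1.+1 &
     forall s t, s \in approxes_below a.2 -> t \in approxes_below a.2 -> is_approx X s -> is_approx X t ->
     exists2 l, subseq b.2 l & subblock X (b.1, l) /\ G s t (b.1, l)].
  move=> [m K].
  have h : W [set b | forall s, s \in approxes_below K -> forall t, t \in approxes_below K ->
      is_approx X s -> is_approx X t -> G s t b].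
    apply: filter_allseq => s _; apply: filter_allseq => t _.
    have [[h1 h2]|h] := pselect (is_approx X s /\ is_approx X t).
      by apply: filterS (HG s t h1 h2) => b gb _ _.
    by apply: filterS filterT => b _ h1 h2; case: h.
  have [b [[bX [b1 b2]] hb]] := ultra_ex WU (ultraI WU (ultraI WU WX (Wn (m.+1 + K))) h).
  exists (b.1, take m.+1 b.2); split=> /=.
  - exact: subblock_sub bX (take_subseq _ _).
  - exact: leq_trans (leq_addl _ _) b1.
  - by rewrite size_takel //; exact: leq_trans (leq_addr _ _) b2.
  - move=> s t sK tK hs ht; exists b.2; first exact: take_subseq.
    by rewrite -surjective_pairing; split=> //; exact: hb.
pose fix g n : blk := if n is m.+1 then f (n, (g m).1.+1) else f (0, 0).
(* One past the number of the previous block, so that an approximation of [Y] below block [n] has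
   all its numbers below [K n]. *)
pose K n := if n is m.+1 then (g m).1.+1 else 0.
have gE n : g n = f (n, K n) by case: n.
have [Y YX hY] := @R1_of_blocks X g
  (fun n => ltac:(by rewrite (gE n.+1); have [_ h _ _] := hf (n.+1, K n.+1); exact: h))
  (fun n => ltac:(by rewrite gE; have [_ _ h _] := hf (n, K n); exact: h))
  (fun n => ltac:(by rewrite gE; have [h _ _ _] := hf (n, K n); exact: h)).
exists Y => // s t b hs ht [m bm sub] bs bt.
have [e1 e2] := hY m.
have inK r : is_approx Y r -> below b.1 r -> r \in approxes_below (K m).
  move=> hr br; apply: (mem_approxes_below hr); apply/allP => c cr.
  have cb : c.1 < b.1 by exact: (allP br).
  have [_ _ /(_ _ cr)[m' em' _]] := hr.
  rewrite bm em' in cb; have mm' := knum_lt cb.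
  case: m mm' {bm sub e1 e2 cb} => // m mm'; rewrite /= ltnS em' -(hY m).1.
  by move: mm'; rewrite ltnS leq_eqVlt => /predU1P[->//|/(knum_incr Y)/ltnW].
have [_ _ _ /(_ s t (inK s hs bs) (inK t ht bt) (is_approx_le YX hs) (is_approx_le YX ht))] := hf (m, K m).
rewrite -gE => -[l gl hl]; exists l; first by apply: subseq_trans gl; rewrite -e2.
by rewrite bm e1.
Qed.

(** * Adjacent lists *)

Definition adjacent (n i : nat) (u v : seq nat) : Prop :=
  [/\ size u = n, size v = n, i < n, nth 0 u i < nth 0 v i
    & forall j, j <> i -> nth 0 u j = nth 0 v j].

(** [bump y] skips the index [y]: dropping element [x.+1] or element [x] from the first [N.+1]
    elements leaves lists that differ at [x] only. *)
Lemma adjacent_ex (l : seq nat) N x : sorted ltn l -> N < size l -> x < N ->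
  exists z1 z2, [/\ subseq z1 l, subseq z2 l & adjacent N x z1 z2].
Proof.
move=> sl Nl xN.
have H y : positions (size l) [seq bump y j | j <- iota 0 N].
  apply/positionsP; split.
    apply: nth_ltn_sorted => i; rewrite size_map size_iota => iN.
    by rewrite !(nth_map 0) ?size_iota ?nth_iota //; rewrite /bump; lia.
  by move=> i /mapP[j]; rewrite mem_iota => jN ->; rewrite /bump; lia.
have E y j : j < N -> nth 0 (sel l [seq bump y j | j <- iota 0 N]) j = nth 0 l (bump y j).
  by move=> jN; rewrite nth_sel ?size_map ?size_iota // (nth_map 0) ?size_iota // nth_iota.
have S y : size (sel l [seq bump y j | j <- iota 0 N]) = N.
  by rewrite size_sel size_map size_iota.
exists (sel l [seq bump x.+1 j | j <- iota 0 N]), (sel l [seq bump x j | j <- iota 0 N]).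
split; rewrite ?sel_subseq //; split=> //.
  by rewrite !E // /bump; apply: sorted_nth_ltn => //; lia.
move=> j jx; have [jN|jN] := ltnP j N; last by rewrite !nth_default ?S.
by rewrite !E //; congr nth; rewrite /bump; lia.
Qed.

Lemma adjacent_sel N x i (z1 z2 p : seq nat) : adjacent N x z1 z2 -> positions N p -> i < size p ->
  nth 0 p i = x -> adjacent (size p) i (sel z1 p) (sel z2 p).
Proof.
move=> [s1 s2 xN lt H] hp ip e; split; rewrite ?size_sel // ?nth_sel ?e //.
move=> j ji; have [jp|jp] := ltnP j (size p); last by rewrite !nth_default ?size_sel.
rewrite !nth_sel //; apply: H => ej; apply: ji.
by apply: (@sorted_nth_inj p); rewrite ?e //; case/positionsP: hp.
Qed.

Lemma adjacent_sel_eq N x (z1 z2 p : seq nat) : adjacent N x z1 z2 -> x \notin p ->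
  sel z1 p = sel z2 p.
Proof.
by move=> [_ _ _ _ H] xp; apply/eq_in_map => j jp; apply: H => e; rewrite -e jp in xp.
Qed.

(** The converse of [adjacent_ex]: an adjacent pair comes from a single list by two deletions, so
    [W] decides properties of adjacent pairs. *)
Lemma adjacent_splice (l : seq nat) n i u v : sorted ltn l -> subseq u l -> subseq v l ->
  adjacent n i u v -> exists z, [/\ subseq z l, size z = n.+1,
    sel z [seq bump i j | j <- iota 0 n] = v &
    sel z [seq bump i.+1 j | j <- iota 0 n] = u].
Proof.
move=> sl ul vl [su sv iN lt H].
have uS := subseq_ltn_sorted ul sl; have vS := subseq_ltn_sorted vl sl.
pose z := take i.+1 u ++ drop i v.
have sz : size z = n.+1 by rewrite size_cat size_takel ?su // size_drop sv; lia.
have nz j : nth 0 z j = if j < i.+1 then nth 0 u j else nth 0 v j.-1.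
  rewrite nth_cat size_takel ?su //.
  case: ltnP => h; first by rewrite nth_take.
  by rewrite nth_drop; congr nth; lia.
exists z; split=> //.
- apply: subset_subseq => //.
    apply: nth_ltn_sorted => j; rewrite sz => jn; rewrite !nz.
    case: (ltngtP j i) => ji.
    + have [-> ->] : (j < i.+1) /\ (j.+1 < i.+1) by lia.
      by apply: sorted_nth_ltn => //; lia.
    + have [-> ->] : (j < i.+1) = false /\ (j.+1 < i.+1) = false by lia.
      by apply: sorted_nth_ltn => //; lia.
    + have [-> ->] : (j < i.+1) /\ (j.+1 < i.+1) = false by lia.
      by rewrite ji.
  move=> x; rewrite mem_cat => /orP[/mem_take|/mem_drop];
    [exact: (mem_subseq ul) | exact: (mem_subseq vl)].
- apply: (@eq_from_nth _ 0); rewrite size_sel size_map size_iota ?sv // => j jn.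
  rewrite nth_sel ?size_map ?size_iota // (nth_map 0) ?size_iota // nth_iota // add0n nz.
  rewrite /bump; case: (leqP i j) => ij /=.
    by rewrite add1n ltnS ltnNge ij.
  by rewrite add0n ltnS (ltnW ij) H //; lia.
- apply: (@eq_from_nth _ 0); rewrite size_sel size_map size_iota ?su // => j jn.
  rewrite nth_sel ?size_map ?size_iota // (nth_map 0) ?size_iota // nth_iota // add0n nz.
  rewrite /bump; case: (leqP i.+1 j) => ij /=.
    by rewrite add1n ltnS ltnNge (ltnW ij) /= H //; lia.
  by rewrite add0n ij.
Qed.

Lemma below_ex s : exists K, below K s.
Proof.
elim: s => [|b s [K h]]; first by exists 0.
exists (b.1.+1 + K); apply/andP; split=> /=; first by lia.
by apply: below_leq h; lia.
Qed.

(** * Mixing *)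

Section Mix.

Variables (X : R1) (W : set_system blk) (F : seq blk -> Prop)
  (E : seq blk -> seq blk -> Prop).

Definition most (N : nat) (P : nat -> seq nat -> Prop) : Prop :=
  W [set b : blk | forall z, subseq z b.2 -> size z = N -> P b.1 z].

(* s and t mix when suitably generic extensions of s and of t in the front can be
   equivalent. The quantifier "for W-most blocks" is spelled out to keep the
   definition strictly positive. *)
Inductive mix : seq blk -> seq blk -> Prop :=
| mix_leaf s t : is_approx X s -> is_approx X t -> F s -> F t -> E s t -> mix s t
| mix_left s t S : ~ F s -> W S ->
    (forall b u, S b -> subseq u b.2 -> size u = (size s).+1 ->
       mix (rcons s (b.1, u)) t) -> mix s t
| mix_right s t S : ~ F t -> W S ->
    (forall b v, S b -> subseq v b.2 -> size v = (size t).+1 ->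
       mix s (rcons t (b.1, v))) -> mix s t
| mix_both s t N p q S : ~ F s -> ~ F t -> W S -> positions N p -> positions N q ->
    size p = (size s).+1 -> size q = (size t).+1 ->
    (forall b z, S b -> subseq z b.2 -> size z = N ->
       mix (rcons s (b.1, sel z p)) (rcons t (b.1, sel z q))) -> mix s t.

(** Extensions are compared with [s] itself instead of with each other; this makes sense because
    mixing relates approximations of different lengths. *)
Definition const_next (s : seq blk) : Prop :=
  most (size s).+1 (fun k u => mix (rcons s (k, u)) s).

(* z without its i-th and without its (i+1)-st element: lists that differ only at
   position i. *)
Definition moved (s : seq blk) (i k : nat) (z : seq nat) : Prop :=
  mix (rcons s (k, sel z [seq bump i j | j <- iota 0 (size s).+1]))
      (rcons s (k, sel z [seq bump i.+1 j | j <- iota 0 (size s).+1])).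

(* The positions of the next block whose leaves are determined by the mixing class. *)
Definition read_positions (s : seq blk) : seq nat :=
  [seq i <- iota 0 (size s).+1 | `[< most (size s).+2 (fun k z => ~ moved s i k z) >]].

Lemma read_positionsP s : positions (size s).+1 (read_positions s).
Proof. exact: filter_subseq. Qed.

Hypotheses (HW : block_ultra X W) (hF : lfront X F).
Hypothesis Erefl : forall s, is_approx X s -> F s -> E s s.
Hypothesis Esym : forall s t, is_approx X s -> is_approx X t -> F s -> F t -> E s t -> E t s.
Hypothesis Etrans : forall s t r, is_approx X s -> is_approx X t -> is_approx X r -> F s -> F t -> F r ->
  E s t -> E t r -> E s r.

Let WU : UltraFilter W. Proof. by case: HW. Qed.
Let WF : Filter W. Proof. by have := WU; move=> [pf _]; exact: filter_filter. Qed.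

Lemma W_big S n : W S -> exists b : blk, [/\ S b, subblock X b, n <= b.1 & n <= size b.2].
Proof.
move=> WS; have [_ WX Wn _] := HW.
by have [b [[? ?] [? ?]]] := ultra_ex WU (ultraI WU (ultraI WU WS WX) (Wn n)); exists b.
Qed.

Lemma most_dec N P : most N P \/ most N (fun k z => ~ P k z).
Proof. by case: HW => _ _ _; exact. Qed.

Lemma most_contra N P : most N P -> most N (fun k z => ~ P k z) -> False.
Proof.
move=> h1 h2; have [b [[b1 b2] _ _ bN]] := W_big N (ultraI WU h1 h2).
have sz : size (take N b.2) = N by rewrite size_takel.
exact: (b2 _ (take_subseq _ _) sz (b1 _ (take_subseq _ _) sz)).
Qed.

Lemma mostS N (P Q : nat -> seq nat -> Prop) : most N P ->
  (forall k z, size z = N -> P k z -> Q k z) -> most N Q.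
Proof. by move=> h PQ; apply: (ultraS WU h) => b hb z zb sz; apply: PQ => //; exact: hb. Qed.

Lemma most_sel N M p P : most N P -> positions M p -> size p = N ->
  most M (fun k z => P k (sel z p)).
Proof.
move=> h hp sp; apply: (ultraS WU h) => b hb z zb sz.
apply: hb; last by rewrite size_sel.
by apply: subseq_trans zb; apply: sel_subseq; rewrite sz.
Qed.

(** [W] decides the property for lists of length [N], and a negative verdict would carry over to
    length [M] by [most_sel]. *)
Lemma most_sel_inv N M p P : most M (fun k z => P k (sel z p)) -> positions M p ->
  size p = N -> most N P.
Proof.
move=> h hp sp; have [//|h'] := most_dec N P.
by case: (most_contra h); exact: most_sel h' hp sp.
Qed.

Lemma mixP s t : mix s t ->
  [\/ [/\ F s, F t & E s t],
      ~ F s /\ most (size s).+1 (fun k u => mix (rcons s (k, u)) t),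
      ~ F t /\ most (size t).+1 (fun k v => mix s (rcons t (k, v)))
    | [/\ ~ F s, ~ F t & exists N p q, [/\ positions N p, positions N q, size p = (size s).+1,
        size q = (size t).+1 &
        most N (fun k z => mix (rcons s (k, sel z p)) (rcons t (k, sel z q)))]]].
Proof.
case=> {s t} [s t _ _ Fs Ft Est|s t S nF WS H|s t S nF WS H|
  s t N p q S nFs nFt WS hp hq sp sq H].
- exact: Or41.
- by apply: Or42; split=> //; apply: (ultraS WU WS) => b Sb z zb sz; exact: H.
- by apply: Or43; split=> //; apply: (ultraS WU WS) => b Sb z zb sz; exact: H.
- apply: Or44; split=> //; exists N, p, q; split=> //.
  by apply: (ultraS WU WS) => b Sb z zb sz; exact: H.
Qed.

Lemma mix_leftQ s t : ~ F s -> most (size s).+1 (fun k u => mix (rcons s (k, u)) t) ->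
  mix s t.
Proof. by move=> nF h; apply: (mix_left nF h) => b u hb ub su; exact: hb. Qed.

Lemma mix_rightQ s t : ~ F t -> most (size t).+1 (fun k v => mix s (rcons t (k, v))) ->
  mix s t.
Proof. by move=> nF h; apply: (mix_right nF h) => b u hb ub su; exact: hb. Qed.

Lemma mix_bothQ s t N p q : ~ F s -> ~ F t -> positions N p -> positions N q ->
  size p = (size s).+1 -> size q = (size t).+1 ->
  most N (fun k z => mix (rcons s (k, sel z p)) (rcons t (k, sel z q))) -> mix s t.
Proof.
by move=> nFs nFt hp hq sp sq h; apply: (mix_both nFs nFt h hp hq sp sq) => b z hb zb sz; exact: hb.
Qed.

Lemma mix_sym s t : mix s t -> mix t s.
Proof.
elim=> {s t} [s t aps apt Fs Ft Est|s t S nF WS _ H|s t S nF WS _ H|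
  s t N p q S nFs nFt WS hp hq sp sq _ H].
- by apply: mix_leaf => //; exact: Esym.
- exact: mix_right nF WS H.
- exact: mix_left nF WS H.
- exact: mix_both nFt nFs WS hq hp sq sp H.
Qed.

Lemma mix_trans_leaf s t r : is_approx X s -> is_approx X t -> F s -> F t -> E s t -> mix t r -> mix s r.
Proof.
move=> aps + Fs + + D; elim: D => {t r} [t r apt' apr _ Fr Etr|t r S nF WS _ H|
  t r S nF WS _ H| t r N p q S nFs nFt WS hp hq sp sq _ H] apt Ft Est //.
  by apply: mix_leaf => //; exact: Etrans Etr.
apply: (mix_right nF WS) => b v Sb vb sv; exact: H.
Qed.

(** Induction on the first derivation and, where it extends [t], an inner one on the second. Steps
    that extend only [s] or only [r] commute with everything; the work lies in the steps where both
    derivations extend [t]. *)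
Lemma mix_trans s t r : mix s t -> mix t r -> mix s r.
Proof.
move=> D; elim: D r => {s t} [s t aps apt Fs Ft Est|s t S nF WS _ H|s t S nF WS _ H|
  s t N p q S nFs nFt WS hp hq sp sq _ H] r.
- exact: mix_trans_leaf Est.
- by move=> tr; apply: (mix_left nF WS) => b u Sb ub su; exact: H.
- move: {-2}t (erefl t) => t' et D; elim: D et => {t' r}
    [t' r _ _ Ft _ _|t' r S' nF' WS' H' _|t' r S' nF' WS' _ H'|
     t' r N' p' q' S' nFs' nFt' WS' hp' hq' sp' sq' H' _] et; subst t' => //.
  (* Both derivations extend [t] alone: one common extension of [t] mixes with [s] and with [r]. *)
  + have [b [[Sb Sb'] _ _ hb]] := W_big (size t).+1 (ultraI WU WS WS').
    have sv : size (take (size t).+1 b.2) = (size t).+1 by rewrite size_takel.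
    exact: (H b _ Sb (take_subseq _ _) sv _ (H' b _ Sb' (take_subseq _ _) sv)).
  + by apply: (mix_right nF' WS') => b v Sb vb sv; exact: H'.
  (* The list along which [t] and [r] grow together is longer than what [r] needs; [most_sel_inv]
     forgets the rest. *)
  + apply: mix_rightQ => //; apply: (@most_sel_inv _ N' q') => //.
    apply: (ultraS WU (ultraI WU WS WS')) => b [Sb Sb'] z zb sz.
    apply: (H b (sel z p')); rewrite ?size_sel //; last exact: H'.
    by apply: subseq_trans zb; apply: sel_subseq; rewrite sz.
- move: {-2}t (erefl t) => t' et D; elim: D et => {t' r}
    [t' r _ _ Ft _ _|t' r S' nF' WS' H' _|t' r S' nF' WS' _ H'|
     t' r N' p' q' S' nFs' nFt' WS' hp' hq' sp' sq' H' _] et; subst t' => //.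
  + apply: mix_leftQ => //; apply: (@most_sel_inv _ N p) => //.
    apply: (ultraS WU (ultraI WU WS WS')) => b [Sb Sb'] z zb sz.
    apply: (H b z Sb zb sz); apply: H' => //; rewrite ?size_sel //.
    by apply: subseq_trans zb; apply: sel_subseq; rewrite sz.
  + by apply: (mix_right nF' WS') => b v Sb vb sv; exact: H'.
  (* Amalgamation makes the extension of [t] in the first pattern equal to the one in the second. *)
  + have [K [e [e' [he he' se se' ee]]]] := amalgam hq hp' (etrans sq (esym sp')).
    apply: (@mix_bothQ _ _ K (sel e p) (sel e' q')); rewrite ?size_sel //.
    * by apply: positions_sel; rewrite ?se.
    * by apply: positions_sel; rewrite ?se'.
    apply: (ultraS WU (ultraI WU WS WS')) => b [Sb Sb'] z zb sz.
    have ze y : positions K y -> subseq (sel z y) b.2.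
      by move=> hy; apply: subseq_trans zb; apply: sel_subseq; rewrite sz.
    rewrite -!sel_sel ?se ?se' //.
    apply: (H b (sel z e) Sb (ze _ he)); rewrite ?size_sel //.
    rewrite sel_sel ?se // ee -sel_sel ?se' //.
    by apply: H' => //; [exact: ze | rewrite size_sel].
Qed.

Lemma W_ext s : is_approx X s -> W [set b : blk | forall u, subseq u b.2 ->
  size u = (size s).+1 -> is_approx X (rcons s (b.1, u))].
Proof.
move=> aps; have [K sK] := below_ex s; have [_ WX Wn _] := HW.
apply: (ultraS WU (ultraI WU WX (Wn K))) => b [bX [bK _]] u ub su.
apply/is_approx_rcons; split=> //; first exact: subblock_sub bX ub.
exact: below_leq bK sK.
Qed.

(** Bar induction with the diagonal pattern, which extends both sides by the same leaves. *)
Lemma mix_refl s : is_approx X s -> live F s -> mix s s.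
Proof.
move=> aps ls; have B := lfront_barred hF aps ls; elim: B aps => {s ls} s.
  by move=> Fs aps; apply: mix_leaf => //; exact: Erefl.
move=> _ IH aps; have [Fs|nFs] := pselect (F s).
  by apply: mix_leaf => //; exact: Erefl.
apply: (@mix_bothQ _ _ (size s).+1 (iota 0 (size s).+1) (iota 0 (size s).+1));
  rewrite ?size_iota //; try exact: subseq_refl.
apply: (ultraS WU (W_ext aps)) => b hb z zb sz.
by rewrite -[X in iota 0 X]sz sel_iota; apply: IH; exact: hb.
Qed.

Definition moves_ok (s : seq blk) (b : blk) : Prop :=
  forall i u v, adjacent (size s).+1 i u v -> subseq u b.2 -> subseq v b.2 ->
    (i \in read_positions s -> ~ mix (rcons s (b.1, u)) (rcons s (b.1, v))) /\
    (i \notin read_positions s -> mix (rcons s (b.1, u)) (rcons s (b.1, v))).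

(** By [adjacent_splice] a move at [i] is a property of one list of length [(size s).+2], and
    [read_positions] records the verdict of [W] on it. *)
Lemma W_moves s : W [set b | moves_ok s b].
Proof.
have [_ WX _ _] := HW.
have h : W [set b : blk | forall i, i \in iota 0 (size s).+1 ->
   forall z, subseq z b.2 -> size z = (size s).+2 ->
   (i \in read_positions s -> ~ moved s i b.1 z) /\ (i \notin read_positions s -> moved s i b.1 z)].
  apply: (filter_allseq WF) => i; rewrite mem_iota => /andP[_ iN].
  have iI : (i \in read_positions s) = `[< most (size s).+2 (fun k z => ~ moved s i k z) >].
    by rewrite mem_filter mem_iota iN leq0n !andbT.
  have [h|h] := pselect (most (size s).+2 (fun k z => ~ moved s i k z)).
    rewrite iI asboolT //; apply: (ultraS WU h) => b hb z zb sz; split=> // _; exact: hb.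
  have [h'|//] := most_dec (size s).+2 (moved s i).
  rewrite iI asboolF //; apply: (ultraS WU h') => b hb z zb sz; split=> // _; exact: hb.
apply: (ultraS WU (ultraI WU h WX)) => b [hb bX] i u v auv ub vb.
have [z [zb sz ev eu]] := adjacent_splice (subblock_sorted bX) ub vb auv.
have iN : i \in iota 0 (size s).+1 by rewrite mem_iota; case: auv.
have [h1 h2] := hb i iN z zb sz; rewrite /moved ev eu in h1 h2.
by split=> [/h1 h' /mix_sym|/h2 /mix_sym].
Qed.

(** The lists [h i] pass from [w] to [u] one position at a time, and only at positions that are not
    read. They stay increasing because [u] is pointwise below [w]. *)
Lemma moves_le s (b : blk) u w : is_approx X s -> live F s -> ~ F s -> subblock X b -> below b.1 s ->
  moves_ok s b -> subseq u b.2 -> subseq w b.2 -> size u = (size s).+1 ->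
  size w = (size s).+1 -> (forall i, nth 0 u i <= nth 0 w i) ->
  (forall i, i \in read_positions s -> nth 0 u i = nth 0 w i) ->
  mix (rcons s (b.1, u)) (rcons s (b.1, w)).
Proof.
move=> aps ls nFs bX bs ok ub wb su sw le eqI.
have uS := subseq_ltn_sorted ub (subblock_sorted bX).
have wS := subseq_ltn_sorted wb (subblock_sorted bX).
pose h i := take i u ++ drop i w.
have sh i : i <= (size s).+1 -> size (h i) = (size s).+1.
  by move=> iN; rewrite size_cat size_take size_drop su sw; case: ltnP; lia.
have nh i j : i <= (size s).+1 -> nth 0 (h i) j = if j < i then nth 0 u j else nth 0 w j.
  move=> iN; rewrite nth_cat size_takel ?su //; case: ltnP => ij; first by rewrite nth_take.
  by rewrite nth_drop; congr nth; lia.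
have hb i : i <= (size s).+1 -> subseq (h i) b.2.
  move=> iN; apply: subset_subseq; last first.
  - move=> x; rewrite mem_cat => /orP[/mem_take|/mem_drop];
      [exact: (mem_subseq ub) | exact: (mem_subseq wb)].
  - exact: subblock_sorted bX.
  apply: nth_ltn_sorted => j; rewrite sh // => jn; rewrite !nh //.
  case: (ltngtP j.+1 i) => ji.
  + by apply: sorted_nth_ltn => //; rewrite ltnSn su.
  + by apply: sorted_nth_ltn => //; rewrite ltnSn sw.
  + apply: leq_ltn_trans (le j) _.
    by apply: sorted_nth_ltn => //; rewrite ltnSn sw.
have H i : i <= (size s).+1 -> mix (rcons s (b.1, h i)) (rcons s (b.1, w)).
  elim: i => [|i IH] iN.
    rewrite /h take0 drop0; apply: mix_refl; last by apply/live_rcons.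
    by apply/is_approx_rcons; split=> //; exact: subblock_sub bX wb.
  have iN' := ltnW iN; apply: mix_trans (IH iN').
  have [e|ne] := eqVneq (nth 0 u i) (nth 0 w i).
    suff -> : h i.+1 = h i.
      by apply: mix_refl; [apply/is_approx_rcons; split=> //; rewrite ?sh //;
        apply: subblock_sub bX (hb _ iN') | apply/live_rcons].
    apply: (@eq_from_nth _ 0); first by rewrite !sh.
    move=> j _; rewrite !nh // ltnS leq_eqVlt.
    by case: eqP => [->|_] //=; rewrite ltnn.
  have iI : i \notin read_positions s by apply/negP => /eqI e; rewrite e eqxx in ne.
  apply: (ok i _ _ _ (hb _ iN) (hb _ iN')).2 => //.
  split; rewrite ?sh // ?nh //.
    by rewrite ltnSn ltnn ltn_neqAle ne le.
  move=> j ji; rewrite !nh //.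
  by rewrite ltnS leq_eqVlt; case: eqP ji.
by have := H _ (leqnn _); rewrite /h -{1}su take_size drop_oversize ?sw // cats0.
Qed.

(** Both [u] and [v] are joined to their pointwise maximum, which is again an increasing sublist of
    [b.2] and agrees with both at the read positions. *)
Lemma moves_eq s (b : blk) u v : is_approx X s -> live F s -> ~ F s -> subblock X b -> below b.1 s ->
  moves_ok s b -> subseq u b.2 -> subseq v b.2 -> size u = (size s).+1 ->
  size v = (size s).+1 -> sel u (read_positions s) = sel v (read_positions s) ->
  mix (rcons s (b.1, u)) (rcons s (b.1, v)).
Proof.
move=> aps ls nFs bX bs ok ub vb su sv /eq_in_map eqI.
have bS := subblock_sorted bX.
have uS := subseq_ltn_sorted ub bS; have vS := subseq_ltn_sorted vb bS.
pose w := mkseq (fun i => maxn (nth 0 u i) (nth 0 v i)) (size s).+1.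
have sw : size w = (size s).+1 by rewrite size_mkseq.
have nw i : nth 0 w i = maxn (nth 0 u i) (nth 0 v i).
  have [h|h] := ltnP i (size s).+1; first by rewrite nth_mkseq.
  by rewrite !nth_default ?sw ?su ?sv.
have wb : subseq w b.2.
  apply: subset_subseq => //.
    apply: nth_ltn_sorted => i; rewrite sw => iN; rewrite !nw.
    have := @sorted_nth_ltn u i i.+1 uS; have := @sorted_nth_ltn v i i.+1 vS.
    by rewrite su sv ltnSn iN => /(_ isT) ? /(_ isT) ?; lia.
  move=> x /(nthP 0)[i]; rewrite sw nw => iN <-.
  by rewrite /maxn; case: ifP => _; [apply: (mem_subseq vb) | apply: (mem_subseq ub)];
    apply: mem_nth; rewrite ?su ?sv.
apply: (@mix_trans _ (rcons s (b.1, w))).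
  apply: moves_le => // i; first by rewrite nw leq_maxl.
  by move=> /eqI e; rewrite nw -e maxnn.
apply: mix_sym; apply: moves_le => // i; first by rewrite nw leq_maxr.
by move=> /eqI e; rewrite nw e maxnn.
Qed.

(** Change [z] at the single index [x]. On the side of [s] a read position moves, so the class
    changes; if [x] were not read on the side of [t], the class there would stay the same, although
    the pattern mixes both times. *)
Lemma pattern_subset s t N p q : positions N p -> positions N q ->
  size p = (size s).+1 -> size q = (size t).+1 ->
  most N (fun k z => mix (rcons s (k, sel z p)) (rcons t (k, sel z q))) ->
  is_approx X t -> live F t -> ~ F t ->
  {subset sel p (read_positions s) <= sel q (read_positions t)}.
Proof.
move=> hp hq sp sq H apt lt nFt x /mapP[i iI ex].
have [//|xq] := boolP (x \in sel q (read_positions t)).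
have ip : i < size p by rewrite sp; case/positionsP: (read_positionsP s) => _; apply.
have xN : x < N by rewrite ex; exact: positions_nth hp ip.
have [b [[hb [ms [mt ext]]] bX _ bN]] := W_big N.+1
  (ultraI WU H (ultraI WU (W_moves s) (ultraI WU (W_moves t) (W_ext apt)))).
have [z1 [z2 [z1b z2b a12]]] := adjacent_ex (subblock_sorted bX) bN xN.
have [s1 s2 _ _ _] := a12.
have sub z y : subseq z b.2 -> size z = N -> positions N y -> subseq (sel z y) b.2.
  by move=> zb sz hy; apply: subseq_trans zb; apply: sel_subseq; rewrite sz.
have as12 := adjacent_sel a12 hp ip (esym ex); rewrite sp in as12.
case: ((ms i _ _ as12 (sub _ _ z1b s1 hp) (sub _ _ z2b s2 hp)).1 iI).
apply: mix_trans (hb z1 z1b s1) _; apply: mix_trans (mix_sym (hb z2 z2b s2)).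
have [xq'|xq'] := boolP (x \in q); last first.
  rewrite (adjacent_sel_eq a12 xq'); apply: mix_refl; last by apply/live_rcons.
  by apply: ext; rewrite ?size_sel //; exact: sub.
have /(nthP 0)[j jq ej] := xq'.
have at12 := adjacent_sel a12 hq jq ej; rewrite sq in at12.
apply: (mt j _ _ at12 (sub _ _ z1b s1 hq) (sub _ _ z2b s2 hq)).2.
apply/negP => jI; move/negP: xq; apply; rewrite -ej; exact: map_f.
Qed.

Lemma pattern_eq s t N p q : positions N p -> positions N q ->
  size p = (size s).+1 -> size q = (size t).+1 ->
  most N (fun k z => mix (rcons s (k, sel z p)) (rcons t (k, sel z q))) ->
  is_approx X s -> is_approx X t -> live F s -> live F t -> ~ F s -> ~ F t ->
  sel p (read_positions s) = sel q (read_positions t).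
Proof.
move=> hp hq sp sq H aps apt ls lt nFs nFt.
have srt r y : positions N r -> size r = (size y).+1 -> sorted ltn (sel r (read_positions y)).
  move=> hr sr; have : positions N (sel r (read_positions y)).
    by apply: positions_sel; rewrite // sr; exact: read_positionsP.
  by case/positionsP.
apply: (irr_sorted_eq ltn_trans ltnn); [exact: srt|exact: srt|].
move=> x; apply/idP/idP; first exact: (pattern_subset hp hq sp sq H).
apply: (pattern_subset hq hp sq sp) => //.
by apply: mostS H _ => k z _; exact: mix_sym.
Qed.

(** Every pair of sublists follows one of finitely many patterns of length at most [n + m], so a
    block can be good for all of them. *)
Lemma most_pairs n m (P : nat -> seq nat -> seq nat -> Prop) :
  (forall N p q, positions N p -> positions N q -> size p = n -> size q = m ->
     most N (fun k z => P k (sel z p) (sel z q))) ->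
  W [set b : blk | forall u v, subseq u b.2 -> subseq v b.2 -> size u = n -> size v = m ->
     P b.1 u v].
Proof.
move=> H; have [_ WX _ _] := HW.
have h : W [set b : blk | forall N, N \in iota 0 (n + m).+1 ->
    forall p, p \in sublists (iota 0 N) -> forall q, q \in sublists (iota 0 N) ->
    [/\ positions N p, positions N q, size p = n & size q = m] ->
    forall z, subseq z b.2 -> size z = N -> P b.1 (sel z p) (sel z q)].
  apply: (filter_allseq WF) => N _; apply: (filter_allseq WF) => p _; apply: (filter_allseq WF) => q _.
  have [[hp hq sp sq]|h] := pselect [/\ positions N p, positions N q, size p = n & size q = m].
    by apply: (ultraS WU (H N p q hp hq sp sq)) => b hb _.
  by apply: (ultraS WU (@filterT _ W WF)) => b _ /h.
apply: (ultraS WU (ultraI WU h WX)) => b [hb bX] u v ub vb su sv.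
have [z [p [q [zb sz hp hq [eu ev]]]]] := pair_pattern (subblock_sorted bX) ub vb.
rewrite eu ev; apply: (hb (size z)) => //.
- by rewrite mem_iota /= add0n ltnS -su -sv.
- exact: mem_sublists.
- exact: mem_sublists.
- by split; rewrite // -?su -?sv ?eu ?ev size_sel.
Qed.

(** * Mixing of generic extensions *)

Lemma mix_const_next_left s t : ~ F s -> mix s t ->
  most (size s).+1 (fun k u => mix (rcons s (k, u)) t) -> const_next s.
Proof.
move=> nFs st h; apply: mostS h _ => k u _ h; apply: mix_trans h _; exact: mix_sym.
Qed.

(** Only the rule that extends [t] alone is applicable. In [transfer] this both keeps partners of
    nonconstant approximations out of [F] and forces the final partner into [F]. *)
Lemma mix_F_const_next s t : mix s t -> F s -> ~ F t -> const_next t.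
Proof.
move=> /[dup] st /mixP[[_ Ft _]|[nFs _]|[nFt h]|[nFs _ _]] //= Fs _.
apply: (@mix_const_next_left t s) => //; first exact: mix_sym.
by apply: mostS h _ => k v _; exact: mix_sym.
Qed.

Lemma mix_nonconst s t : mix s t -> ~ F s -> ~ F t -> ~ const_next s -> ~ const_next t ->
  exists N p q, [/\ positions N p, positions N q, size p = (size s).+1, size q = (size t).+1 &
    most N (fun k z => mix (rcons s (k, sel z p)) (rcons t (k, sel z q)))].
Proof.
move=> /[dup] st /mixP[[Fs _ _]|[_ h]|[_ h]|[_ _ h]] //= nFs nFt cs ct.
  by case: cs; exact: mix_const_next_left st h.
case: ct; apply: (@mix_const_next_left t s) => //; first exact: mix_sym.
by apply: mostS h _ => k v _; exact: mix_sym.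
Qed.

Lemma mix_size_read_positions s t : mix s t -> is_approx X s -> is_approx X t -> live F s -> live F t ->
  ~ F s -> ~ F t -> ~ const_next s -> ~ const_next t -> size (read_positions s) = size (read_positions t).
Proof.
move=> st aps apt ls lt nFs nFt cs ct.
have [N [p [q [hp hq sp sq h]]]] := mix_nonconst st nFs nFt cs ct.
by rewrite -(size_sel p) (pattern_eq hp hq sp sq h) // size_sel.
Qed.

(** [gen1] treats a block added on one side, [gen2] the same block number added on both; together
    they compute mixing by recursion. *)
Definition gen1 (s t : seq blk) (b : blk) : Prop :=
  forall u, subseq u b.2 -> size u = (size s).+1 ->
    (mix (rcons s (b.1, u)) t <-> mix s t /\ const_next s).

Definition gen2 (s t : seq blk) (b : blk) : Prop :=
  forall u v, subseq u b.2 -> subseq v b.2 -> size u = (size s).+1 ->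
    size v = (size t).+1 ->
    (mix (rcons s (b.1, u)) (rcons t (b.1, v)) <->
     mix s t /\ ((const_next s /\ const_next t) \/
       [/\ ~ const_next s, ~ const_next t & sel u (read_positions s) = sel v (read_positions t)])).

Lemma W_gen1 s t : ~ F s -> W (gen1 s t).
Proof.
move=> nFs.
have [h|h] := most_dec (size s).+1 (fun k u => mix (rcons s (k, u)) t).
  have st : mix s t by exact: mix_leftQ.
  have cs : const_next s by exact: mix_const_next_left st h.
  by apply: (ultraS WU h) => b hb u ub su; split=> // _; exact: hb.
apply: (ultraS WU h) => b hb u ub su; split; first by move/(hb u ub su).
case=> st cs; case: (most_contra _ h).
by apply: mostS cs _ => k z _ zs; exact: mix_trans zs st.
Qed.

(** One mixing pattern [p0], [q0] exists; any pattern that agrees along the read positions is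
    compared with it. *)
Lemma W_gen2_nonconst s t : is_approx X s -> is_approx X t -> live F s -> live F t -> ~ F s -> ~ F t ->
  mix s t -> ~ const_next s -> ~ const_next t ->
  W [set b : blk | forall u v, subseq u b.2 -> subseq v b.2 -> size u = (size s).+1 ->
    size v = (size t).+1 -> sel u (read_positions s) = sel v (read_positions t) ->
    mix (rcons s (b.1, u)) (rcons t (b.1, v))].
Proof.
move=> aps apt ls lt nFs nFt st cs ct.
have [N0 [p0 [q0 [hp0 hq0 sp0 sq0 h0]]]] := mix_nonconst st nFs nFt cs ct.
have e0 := pattern_eq hp0 hq0 sp0 sq0 h0 aps apt ls lt nFs nFt.
apply: (@most_pairs _ _ (fun k u v => sel u (read_positions s) = sel v (read_positions t) ->
  mix (rcons s (k, u)) (rcons t (k, v)))) => N p q hp hq sp sq.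
have [//|h] := most_dec N (fun k z => sel (sel z p) (read_positions s) = sel (sel z q) (read_positions t) ->
   mix (rcons s (k, sel z p)) (rcons t (k, sel z q))).
have Is : positions (size p) (read_positions s) by rewrite sp; exact: read_positionsP.
have It : positions (size q) (read_positions t) by rewrite sq; exact: read_positionsP.
have Is0 : positions (size p0) (read_positions s) by rewrite sp0; exact: read_positionsP.
have It0 : positions (size q0) (read_positions t) by rewrite sq0; exact: read_positionsP.
have hpI := positions_sel hp Is; have hqI := positions_sel hq It.
have hpI0 := positions_sel hp0 Is0.
(* [h] negates an implication, so its premise holds on an actual list; injectivity of [sel] turns
   equal leaves into equal positions. *)
have epq : sel p (read_positions s) = sel q (read_positions t).
  have [b [hb bX _ bN]] := W_big N h.
  have sz : size (take N b.2) = N by rewrite size_takel.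
  have {hb} /not_implyP[e _] := hb _ (take_subseq _ _) sz.
  move: e; rewrite !sel_sel //; apply: sel_inj; rewrite ?sz //.
  exact: subseq_ltn_sorted (take_subseq _ _) (subblock_sorted bX).
(* One list of length [K] carries both patterns, with their read positions in the same places. *)
have [K [e [e' [he he' se se' ee]]]] := amalgam hpI hpI0 (etrans (size_sel _ _) (esym (size_sel _ _))).
have [Ks sKs] := below_ex s; have [Kt tKt] := below_ex t.
have [b [[hb [hb0 [ms mt]]] bX bK1 bK2]] := W_big (K + Ks + Kt)
  (ultraI WU h (ultraI WU h0 (ultraI WU (W_moves s) (W_moves t)))).
pose Z := take K b.2.
have sZ : size Z = K.
  by apply: size_takel; apply: leq_trans bK2; rewrite -addnA leq_addr.
have Zb : subseq Z b.2 by exact: take_subseq.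
have sub y : positions K y -> subseq (sel Z y) b.2.
  by move=> hy; apply: subseq_trans Zb; apply: sel_subseq; rewrite sZ.
have sub2 y r : positions K y -> positions (size y) r -> subseq (sel (sel Z y) r) b.2.
  by move=> hy hr; rewrite sel_sel //; apply: sub; exact: positions_sel.
case: (hb (sel Z e) (sub _ he)); first by rewrite size_sel.
move=> _.
have bs : below b.1 s.
  by apply: below_leq sKs; apply: leq_trans bK1; rewrite -addnA addnCA leq_addr.
have bt : below b.1 t by apply: below_leq tKt; apply: leq_trans bK1; rewrite leq_addl.
(* Move the leaves on the side of [s] away from its read positions, apply the known pattern, then
   move back on the side of [t]. *)
apply: (@mix_trans _ (rcons s (b.1, sel (sel Z e') p0))).
  apply: moves_eq => //; rewrite ?size_sel ?sub2 ?se ?se' //.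
  rewrite (sel_sel _ Is) (sel_sel _ Is0) !sel_sel ?ee ?se ?se' //.
apply: (@mix_trans _ (rcons t (b.1, sel (sel Z e') q0))).
  by apply: hb0; [exact: sub | rewrite size_sel].
apply: moves_eq => //; rewrite ?size_sel ?sub2 ?se ?se' //.
rewrite (sel_sel _ It) (sel_sel _ It0) -e0 -epq.
by rewrite !sel_sel ?ee ?se ?se'.
Qed.

Lemma W_gen2 s t : is_approx X s -> is_approx X t -> live F s -> live F t -> ~ F s -> ~ F t ->
  W (gen2 s t).
Proof.
move=> aps apt ls lt nFs nFt.
have [st|nst] := pselect (mix s t); last first.
  have := @most_pairs (size s).+1 (size t).+1 (fun k u v =>
    ~ mix (rcons s (k, u)) (rcons t (k, v))) => h.
  apply: (ultraS WU (h _)) => [N p q hp hq sp sq|b hb u v ub vb su sv]; last first.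
    by split=> [/(hb u v ub vb su sv)|[]].
  (* A single pattern that mixes almost surely would already give [mix s t]. *)
  have [h'|//] := most_dec N (fun k z => mix (rcons s (k, sel z p)) (rcons t (k, sel z q))).
  by case: nst; exact: mix_bothQ h'.
have ts := mix_sym st.
have h1 x y := ultraI WU (W_gen1 x nFs) (W_gen1 y nFt).
have [cs|cs] := pselect (const_next s); have [ct|ct] := pselect (const_next t).
- apply: (ultraS WU (h1 s t)) => b [b1 b2] u v ub vb su sv.
  split=> [_|_]; first by split=> //; left.
  apply: (@mix_trans _ s); first by apply/(b1 u ub su); split=> //; exact: mix_refl.
  by apply: mix_trans st (mix_sym _); apply/(b2 v vb sv); split=> //; exact: mix_refl.
- apply: (ultraS WU (h1 s s)) => b [b1 b2] u v ub vb su sv.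
  split=> [h|[_ [[]|[]]] //]; case: ct.
  apply: ((b2 v vb sv).1 _).2; apply: mix_trans (mix_sym h) _.
  by apply/(b1 u ub su); split=> //; exact: mix_refl.
- apply: (ultraS WU (h1 t t)) => b [b1 b2] u v ub vb su sv.
  split=> [h|[_ [[]|[]]] //]; case: cs.
  apply: ((b1 u ub su).1 _).2; apply: mix_trans h _.
  by apply/(b2 v vb sv); split=> //; exact: mix_refl.
- have h2 := @most_pairs (size s).+1 (size t).+1 (fun k u v =>
    mix (rcons s (k, u)) (rcons t (k, v)) -> sel u (read_positions s) = sel v (read_positions t)).
  apply: (ultraS WU (ultraI WU (h2 _) (W_gen2_nonconst aps apt ls lt nFs nFt st cs ct))).
    move=> N p q hp hq sp sq.
    have [h|h] := most_dec N (fun k z => mix (rcons s (k, sel z p)) (rcons t (k, sel z q))).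
      apply: (mostS h) => k z _ _ _.
      have := pattern_eq hp hq sp sq h aps apt ls lt nFs nFt.
      by rewrite !sel_sel ?sp ?sq ?read_positionsP // => ->.
    by apply: mostS h _ => k z _ h' /h'.
  move=> b [b1 b2] u v ub vb su sv; split.
    by move=> h; split=> //; right; split=> //; exact: b1 h.
  by move=> [_ [[]|[_ _ e]]] //; exact: b2.
Qed.

End Mix.

(** * The Nash-Williams partition theorem *)

(** Generic truth of [P] at the front above [s], by the same recursion along [W] as for mixing. *)
Inductive majority (W : set_system blk) (F P : seq blk -> Prop) (s : seq blk) : Prop :=
| majority_leaf : F s -> P s -> majority W F P s
| majority_node S : ~ F s -> W S ->
    (forall b u, S b -> subseq u b.2 -> size u = (size s).+1 ->
       majority W F P (rcons s (b.1, u))) -> majority W F P s.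

(** After fusion, adding a block of [Y] never changes the generic verdict, so the verdict at the
    empty approximation reaches every member of the front inside [Y]. *)
Lemma nash_williams X F P : lfront X F -> exists2 Y, leR1 Y X &
  (forall a, is_approx Y a -> F a -> P a) \/ (forall a, is_approx Y a -> F a -> ~ P a).
Proof.
move=> hF; have [W HW] := block_ultra_ex X; have [WU _ _ dec] := HW.
pose G s (t : seq blk) : set blk := [set b | ~ F s -> forall u, subseq u b.2 ->
  size u = (size s).+1 -> (majority W F P (rcons s (b.1, u)) <-> majority W F P s)].
have HG s t : is_approx X s -> is_approx X t -> W (G s t).
  move=> _ _; have [Fs|nFs] := pselect (F s).
    by apply: (ultraS WU (@filterT _ W _)) => b _ /(_ Fs).
  have [h|h] := dec (size s).+1 (fun k u => majority W F P (rcons s (k, u))).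
    have cs : majority W F P s by apply: (majority_node nFs h) => b u hb; exact: hb.
    by apply: (ultraS WU h) => b hb _ u ub su; split=> // _; exact: hb.
  apply: (ultraS WU h) => b hb _ u ub su; split; first by move/(hb u ub su).
  case=> [//|S _ WS H].
  have [_ _ Wn _] := HW.
  have [b' [[Sb' hb'] [_ bs]]] := ultra_ex WU (ultraI WU (ultraI WU WS h) (Wn (size s).+1)).
  have sz : size (take (size s).+1 b'.2) = (size s).+1 by rewrite size_takel.
  by case: (hb' _ (take_subseq _ _) sz); apply: H => //; exact: take_subseq.
have [Y YX hY] := fusion HW HG; exists Y => //.
have H s : is_approx Y s -> live F s -> (majority W F P s <-> majority W F P [::]).
  elim/last_ind: s => [//|s b IH] /is_approx_rcons[aps bY sb bs] /live_rcons[ls nFs].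
  rewrite -(IH aps ls).
  have [l bl [_ /(_ nFs b.2 bl sb)]] := hY s s b aps aps bY bs bs.
  by rewrite /= -surjective_pairing.
have colF a : F a -> (majority W F P a <-> P a).
  by move=> Fa; split=> [|Pa]; [case | exact: majority_leaf].
have hY' := (lfront_le YX hF).2.
have [c|c] := pselect (majority W F P [::]); [left|right] => a apa Fa.
  by apply/(colF _ Fa)/H => //; exact: hY'.
by move/(colF _ Fa)/H => h; apply: c; apply: h => //; exact: hY'.
Qed.

Lemma list_bound (T : eqType) (Q : T -> nat -> Prop) (r : seq T) :
  (forall x, exists M, forall M', M <= M' -> Q x M') ->
  exists M, forall M', M <= M' -> forall x, x \in r -> Q x M'.
Proof.
move=> H; elim: r => [|x r [M hM]]; first by exists 0.
have [M1 hM1] := H x; exists (M + M1) => M' le y; rewrite inE => /predU1P[->|yr].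
  by apply: hM1; lia.
by apply: hM => //; lia.
Qed.

Lemma is_approx_size_le Y c r : is_approx Y r -> below (knum Y c) r -> size r <= c.
Proof.
elim/last_ind: r c => [//|r b IH] c /is_approx_rcons[apr [m e _] _ br].
rewrite below_rcons size_rcons => /andP[+ _]; rewrite e => /knum_lt mc.
by rewrite e in br; have := IH m apr br; lia.
Qed.

Lemma subblock_same X (b c : blk) : subblock X b -> subblock X c -> b.1 = c.1 ->
  exists l, [/\ subblock X (b.1, l), subseq b.2 l & subseq c.2 l].
Proof.
move=> [m em hm] [n en hn] e; exists (leaf_list X m); split=> //; first by exists m.
by move: e; rewrite em en => /knum_inj ->.
Qed.

(** * Canonical inner maps *)

Section Canon.

Variables (A : R1) (W : set_system blk) (F : seq blk -> Prop)
  (E : seq blk -> seq blk -> Prop).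
Hypotheses (HW : block_ultra A W) (hF : lfront A F).
Hypothesis Erefl : forall s, is_approx A s -> F s -> E s s.
Hypothesis Esym : forall s t, is_approx A s -> is_approx A t -> F s -> F t -> E s t -> E t s.
Hypothesis Etrans : forall s t r, is_approx A s -> is_approx A t -> is_approx A r -> F s -> F t -> F r ->
  E s t -> E t r -> E s r.

Local Notation mix := (mix A W F E).
Local Notation const_next := (const_next A W F E).
Local Notation read_positions := (read_positions A W F E).

Definition generic (C : R1) : Prop :=
  forall s t b, is_approx C s -> is_approx C t -> subblock C b -> below b.1 s -> below b.1 t ->
    live F s -> live F t -> ~ F s ->
    gen1 A W F E s t b /\ (~ F t -> gen2 A W F E s t b).

Lemma generic_ex : exists2 C, leR1 C A & generic C.
Proof.
pose G s t : set blk := [set b | live F s -> live F t -> ~ F s ->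
    gen1 A W F E s t b /\ (~ F t -> gen2 A W F E s t b)].
have [WU _ _ _] := HW.
have T P : (forall b, P b) -> W P by move=> h; apply: (ultraS WU (@filterT _ W _)).
have HG s t : is_approx A s -> is_approx A t -> W (G s t).
  move=> aps apt.
  have [ls|nls] := pselect (live F s); last by apply: T => b /nls.
  have [lt|nlt] := pselect (live F t); last by apply: T => b _ /nlt.
  have [Fs|nFs] := pselect (F s); first by apply: T => b _ _ /(_ Fs).
  have h1 : W (gen1 A W F E s t) by exact: W_gen1.
  have [Ft|nFt] := pselect (F t).
    by apply: (ultraS WU h1) => b gb _ _ _; split=> // /(_ Ft).
  have h2 : W (gen2 A W F E s t) by exact: W_gen2.
  by apply: (ultraS WU (ultraI WU h1 h2)) => b [g1 g2] _ _ _; split.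
have [C CA hC] := fusion HW HG; exists C => // s t b aps apt bC bs bt ls lt nFs.
(* [gen1] and [gen2] quantify over sublists, hence pass from [(b.1, l)] to [b]. *)
have [l bl [_ /(_ ls lt nFs)[g1 g2]]] := hC s t b aps apt bC bs bt.
split=> [u ub|/g2 {}g2 u v ub vb].
  by apply: g1; exact: subseq_trans ub bl.
by apply: g2; [exact: subseq_trans ub bl | exact: subseq_trans vb bl].
Qed.

(** A nonconstant approximation contributes its next block number even when it reads no leaf; then
    the number alone carries the information. *)
Definition canon_blocks (s : seq blk) : seq blk :=
  flatten [seq if `[< const_next (take n s) >] then [::] else
     [:: ((nth (0, [::]) s n).1, sel (nth (0, [::]) s n).2 (read_positions (take n s))) : blk]
     | n <- iota 0 (size s)].

Lemma canon_blocks_rcons s (b : blk) : canon_blocks (rcons s b) =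
  canon_blocks s ++ (if `[< const_next s >] then [::] else [:: (b.1, sel b.2 (read_positions s)) : blk]).
Proof.
rewrite /canon_blocks size_rcons -[in iota 0 _](addn1 (size s)) iotaD map_cat flatten_cat; congr (_ ++ _).
  congr flatten; apply/eq_in_map => n; rewrite mem_iota /= add0n => ns.
  by rewrite nth_rcons ns -cats1 takel_cat // ltnW.
by rewrite /= cats0 add0n nth_rcons ltnn eqxx -cats1 take_size_cat.
Qed.

Lemma canon_blocks_rcons_const_next s b : const_next s -> canon_blocks (rcons s b) = canon_blocks s.
Proof. by move=> cs; rewrite canon_blocks_rcons asboolT // cats0. Qed.

Lemma canon_blocks_rcons_nonconst s (b : blk) : ~ const_next s ->
  canon_blocks (rcons s b) = rcons (canon_blocks s) (b.1, sel b.2 (read_positions s)).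
Proof. by move=> cs; rewrite canon_blocks_rcons asboolF // cats1. Qed.

Lemma canon_blocks_below K s : below K s -> below K (canon_blocks s).
Proof.
elim/last_ind: s => [//|s b IH]; rewrite below_rcons => /andP[bK /IH h].
have [cs|cs] := pselect (const_next s); first by rewrite canon_blocks_rcons_const_next.
by rewrite canon_blocks_rcons_nonconst // below_rcons bK.
Qed.

Lemma canon_blocks_sub X s d : is_approx X s -> d \in canon_blocks s ->
  exists2 b, b \in s & d.1 = b.1 /\ subseq d.2 b.2.
Proof.
elim/last_ind: s => [//|s b IH] /is_approx_rcons[aps bX sb bs].
have H : d \in canon_blocks s -> exists2 b0, b0 \in rcons s b & d.1 = b0.1 /\ subseq d.2 b0.2.
  by case/(IH aps) => c cs h; exists c => //; rewrite mem_rcons inE cs orbT.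
have [cs|cs] := pselect (const_next s); first by rewrite canon_blocks_rcons_const_next.
rewrite canon_blocks_rcons_nonconst // mem_rcons inE => /predU1P[->|//].
exists b; first by rewrite mem_rcons mem_head.
by split=> //; apply: sel_subseq; rewrite sb; exact: read_positionsP.
Qed.

Lemma canon_blocks_sorted X s : is_approx X s -> sorted ltn (unzip1 (canon_blocks s)).
Proof.
elim/last_ind: s => [//|s b IH] /is_approx_rcons[aps bX sb bs].
have [cs|cs] := pselect (const_next s); first by rewrite canon_blocks_rcons_const_next // IH.
rewrite canon_blocks_rcons_nonconst // /unzip1 map_rcons (sorted_pairwise ltn_trans) pairwise_rcons.
rewrite -(sorted_pairwise ltn_trans) IH // andbT all_map; exact: canon_blocks_below.
Qed.

Lemma canon_blocks_subblock X s d : is_approx X s -> d \in canon_blocks s -> subblock X d.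
Proof.
move=> aps /(canon_blocks_sub aps)[b bs [e sub]]; have [_ _ /(_ _ bs) bX] := aps.
by rewrite (surjective_pairing d) e; exact: subblock_sub bX sub.
Qed.

Section Generic.

Variable C : R1.
Hypotheses (CA : leR1 C A) (gC : generic C).

Let refl s : is_approx C s -> live F s -> mix s s.
Proof. by move=> aps ls; apply: mix_refl => //; exact: is_approx_le CA aps. Qed.

Let sym s t : mix s t -> mix t s.
Proof. exact: mix_sym. Qed.

Lemma gen_rcons s t (b : blk) : is_approx C (rcons s b) -> is_approx C t -> live F (rcons s b) ->
  live F t -> below b.1 t -> (mix (rcons s b) t <-> mix s t /\ const_next s).
Proof.
move=> /is_approx_rcons[aps bC sb bs] apt /live_rcons[ls nFs] lt bt.
have [g _] := gC aps apt bC bs bt ls lt nFs.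
by have := g b.2 (subseq_refl _) sb; rewrite -surjective_pairing.
Qed.

Lemma gen_rcons2 s t (b c : blk) : is_approx C (rcons s b) -> is_approx C (rcons t c) ->
  live F (rcons s b) -> live F (rcons t c) -> b.1 = c.1 ->
  (mix (rcons s b) (rcons t c) <-> mix s t /\ ((const_next s /\ const_next t) \/
       [/\ ~ const_next s, ~ const_next t & sel b.2 (read_positions s) = sel c.2 (read_positions t)])).
Proof.
move=> /is_approx_rcons[aps bC sb bs] /is_approx_rcons[apt cC sc ct] /live_rcons[ls nFs].
move=> /live_rcons[lt nFt] e.
have [l [lC bl cl]] := subblock_same bC cC e.
have ct' : below b.1 t by rewrite e.
have [_ /(_ nFt) g] := gC aps apt lC bs ct' ls lt nFs.
have := g b.2 c.2 bl cl sb sc; rewrite /= {2}e -!surjective_pairing; exact.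
Qed.

(** Induction on the total length, removing the last block with the larger number, or both if the
    numbers agree. A nonconstant step on one side records a number above everything on the other
    side, so the images differ as [gen1] predicts; equal numbers fall under [gen2]. *)
Lemma mix_canon_blocks s t : is_approx C s -> is_approx C t -> live F s -> live F t -> (mix s t <-> canon_blocks s = canon_blocks t).
Proof.
have step s' t' (b : blk) : is_approx C (rcons s' b) -> is_approx C t' -> live F (rcons s' b) ->
    live F t' -> below b.1 t' -> (mix s' t' <-> canon_blocks s' = canon_blocks t') ->
    (mix (rcons s' b) t' <-> canon_blocks (rcons s' b) = canon_blocks t').
  move=> aps apt ls lt bt IH; rewrite (gen_rcons aps apt ls lt bt) IH.
  have [cs|cs] := pselect (const_next s'); first by rewrite canon_blocks_rcons_const_next //; split=> [[]|].
  rewrite canon_blocks_rcons_nonconst //; split=> [[]//|e].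
  by have := canon_blocks_below bt; rewrite -e below_rcons /= ltnn.
have [n] := ubnP (size s + size t); elim: n s t => // n IH s t.
case/lastP: s => [|s b]; case/lastP: t => [|t c] sz aps apt ls lt.
- by split=> // _; exact: refl.
- have sym_iff x y : (mix x y <-> mix y x) by split; exact: sym.
  rewrite sym_iff; split=> [|/esym] h; [apply: esym|]; move: h; apply step => //;
    have [apt' _ _ _] := (is_approx_rcons _ _ _).1 apt; have [lt' _] := (live_rcons _ _ _).1 lt;
    by apply: IH => //; move: sz; rewrite size_rcons /=; lia.
- apply: step => //; have [aps' _ _ _] := (is_approx_rcons _ _ _).1 aps.
  have [ls' _] := (live_rcons _ _ _).1 ls.
  by apply: IH => //; move: sz; rewrite size_rcons /=; lia.
have [aps' _ _ bs] := (is_approx_rcons _ _ _).1 aps; have [ls' nFs] := (live_rcons _ _ _).1 ls.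
have [apt' _ _ ct] := (is_approx_rcons _ _ _).1 apt; have [lt' nFt] := (live_rcons _ _ _).1 lt.
move: sz; rewrite !size_rcons => sz.
case: (ltngtP b.1 c.1) => bc.
- have sym_iff x y : (mix x y <-> mix y x) by split; exact: sym.
  rewrite sym_iff; split=> [|/esym] h; [apply: esym|]; move: h; apply step => //;
    by [rewrite below_rcons bc (below_leq (ltnW bc)) | apply: IH => //; rewrite size_rcons; lia].
- apply: step => //; first by rewrite below_rcons bc (below_leq (ltnW bc)).
  by apply: IH => //; rewrite size_rcons; lia.
have IHst : mix s t <-> canon_blocks s = canon_blocks t by apply: IH => //; lia.
rewrite (gen_rcons2 aps apt ls lt bc) IHst.
have bt : below b.1 (canon_blocks t) by rewrite bc; exact: canon_blocks_below.
have bs' : below c.1 (canon_blocks s) by rewrite -bc; exact: canon_blocks_below.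
have [cs|cs] := pselect (const_next s); have [ct'|ct'] := pselect (const_next t);
  rewrite ?(canon_blocks_rcons_const_next _ cs) ?(canon_blocks_rcons_const_next _ ct')
    ?(canon_blocks_rcons_nonconst _ cs) ?(canon_blocks_rcons_nonconst _ ct').
- by split=> [[]|] //; split=> //; left.
- split=> [[_ [[]|[]]]//|e].
  by move: bs'; rewrite e below_rcons /= ltnn.
- split=> [[_ [[]|[]]]//|e].
  by move: bt; rewrite -e below_rcons /= ltnn.
- split=> [[-> [[]//|[_ _ ->]]]|/eqP]; first by rewrite bc.
  rewrite eqseq_rcons => /andP[/eqP e1 /eqP[_ e2]]; split=> //; right; by split.
Qed.

Lemma mix_F a b : is_approx C a -> is_approx C b -> F a -> F b -> (mix a b <-> E a b).
Proof.
move=> apa apb Fa Fb; split; last by apply: mix_leaf => //; exact: is_approx_le CA _.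
by move=> /(mixP HW)[[_ _]|[]|[]|[]] // /(_ Fa).
Qed.

(** * Partners that meet a sparse member only in the image *)

Definition avoid (C2 : R1) (r : seq blk) : Prop :=
  forall (c : blk) m, c \in r -> c.1 = knum C2 m -> exists2 d : blk, d \in canon_blocks r &
    d.1 = c.1 /\ forall x, x \in c.2 -> x \in leaf_list C2 m -> x \in d.2.

Variable C1 : R1.
Hypothesis C1C : leR1 C1 C.

(** [q] runs through constant approximations, leaving class and image unchanged, until the front or
    a nonconstant approximation is reached. The indices [c] and [M] confine it, so that it can be
    kept away from the blocks of [C2]. *)
Definition extends_to (c M : nat) (r q : seq blk) : Prop :=
  [/\ is_approx C1 (r ++ q), live F (r ++ q), F (r ++ q) \/ ~ const_next (r ++ q),
      mix (r ++ q) r /\ canon_blocks (r ++ q) = canon_blocks r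
    & (forall d : blk, d \in q -> knum C1 c <= d.1) /\ below (knum C1 M) (r ++ q)].

Lemma extends_ex c r : is_approx C1 r -> live F r -> below (knum C1 c) r ->
  exists M q, extends_to c M r q.
Proof.
move=> apr lr; have hF1 := lfront_le (leR1_trans C1C CA) hF.
have B := lfront_barred hF1 apr lr; elim: B c apr lr => {r} r H.
  move=> c apr lr br; exists c, [::]; rewrite /extends_to cats0.
  by split=> //; [left | split=> //; apply: refl (is_approx_le C1C apr) lr].
move=> IH c apr lr br.
have [h|h] := pselect (F r \/ ~ const_next r).
  exists c, [::]; rewrite /extends_to cats0.
  by split=> //; split=> //; apply: refl (is_approx_le C1C apr) lr.
have [nFr cr] : ~ F r /\ const_next r by split; [|apply: contrapT]; move=> h'; apply: h; tauto.
pose u := take (size r).+1 (leaf_list C1 c).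
(* [r] has at most [c] blocks, because their numbers lie below that of block [c]; so block [c] has
   enough leaves. *)
have su : size u = (size r).+1 by rewrite size_takel // size_leaf_list ltnS; exact: is_approx_size_le apr br.
pose b : blk := (knum C1 c, u).
have apb : is_approx C1 (rcons r b).
  by apply/is_approx_rcons; split=> //; exists c => //; exact: take_subseq.
have lb : live F (rcons r b) by apply/live_rcons.
have [|M [q [h1 h2 h3 [h4 h5] [h6 h7]]]] := IH b apb c.+1 apb lb.
  by rewrite below_rcons /= knum_incr // (below_leq _ br) // ltnW // knum_incr.
exists M, (b :: q); rewrite /extends_to -cat_rcons; split=> //.
  split; last by rewrite h5 canon_blocks_rcons_const_next.
  apply: mix_trans h4 _ => //.
  apply/gen_rcons => //; [exact: is_approx_le C1C _ | exact: is_approx_le C1C _|].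
  by split=> //; apply: refl (is_approx_le C1C apr) lr.
split=> // d; rewrite inE => /predU1P[->//|/h6].
by apply: leq_trans; exact: ltnW (knum_incr _ _).
Qed.

(** Finitely many [r] lie below a given block, so the upper index can depend on [c] alone; [g]
    dictates the gaps of [C2]. *)
Lemma extends_uniform : exists g : nat -> nat, forall c, c <= g c /\
  forall r, is_approx C1 r -> live F r -> below (knum C1 c) r -> exists q, extends_to c (g c) r q.
Proof.
suff /choice [g hg] : forall c, exists M, c <= M /\ forall r, is_approx C1 r -> live F r ->
    below (knum C1 c) r -> exists q, extends_to c M r q by exists g.
move=> c.
have [r|M hM] := @list_bound (seq blk) (fun r M => is_approx C1 r -> live F r ->
    below (knum C1 c) r -> exists q, extends_to c M r q) (approxes_below (knum C1 c)).
  have [[h1 h2 h3]|h] := pselect [/\ is_approx C1 r, live F r & below (knum C1 c) r]; last first.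
    by exists 0 => M _ *; case: h.
  have [M [q [k1 k2 k3 k4 [k5 k6]]]] := extends_ex h1 h2 h3.
  exists M => M' MM _ _ _; exists q; split=> //; split=> //.
  apply: below_leq k6; move: MM; rewrite leq_eqVlt => /predU1P[->//|].
  by move/(knum_incr C1)/ltnW.
exists (M + c); split; first exact: leq_addl.
by move=> r h1 h2 h3; apply: hM => //; [exact: leq_addr | exact: mem_approxes_below h1 h3].
Qed.

(* The blocks of C2 are sparse in C1, so that a member of the front can be rebuilt
   inside C1 with the same image and everything else disjoint from C2. *)
Lemma transfer : exists2 C2, leR1 C2 C1 & forall a, is_approx C a -> F a ->
  (forall d, d \in canon_blocks a -> subblock C2 d) ->
  exists b, [/\ is_approx C1 b, F b, canon_blocks b = canon_blocks a & avoid C2 b].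
Proof.
have [g hg] := extends_uniform.
(* [m i] is the index in [C1] of the block that hosts block [i] of [C2], and [cc i] is the first
   index after the previous host. Going past [g (cc i)] leaves room for continuations; the product
   supplies the leaves that [spaced_sublist] requires with [n0] equal to [g (cc i)]. *)
pose mm i c := g c + i.+2 * (g c).+2.
pose fix cc i := if i is j.+1 then (mm j (cc j)).+1 else 0.
pose m i := mm i (cc i).
have ccS i : cc i.+1 = (m i).+1 by [].
have m_ge i : g (cc i) <= m i by exact: leq_addr.
have cc_m i : cc i <= m i by apply: leq_trans (m_ge i); exact: (hg _).1.
have cc_mono i j : i <= j -> cc i <= cc j.
  elim: j => [|j IH]; first by rewrite leqn0 => /eqP ->.
  rewrite leq_eqVlt => /predU1P[->//|]; rewrite ltnS => /IH h.
  by rewrite ccS; have := cc_m j; lia.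
have m_mono i : m i < m i.+1 by have := cc_m i.+1; rewrite ccS.
have /choice [l hl] : forall i, exists l2, [/\ subseq l2 (leaf_list C1 (m i)), size l2 = i.+1 &
    forall w J n, n <= (g (cc i)).+1 -> positions n J -> subseq w l2 -> size w = size J ->
    exists v, [/\ subseq v (leaf_list C1 (m i)), size v = n, sel v J = w &
       forall x, x \in v -> x \in l2 -> x \in w]].
  move=> i; apply: spaced_sublist; first exact: leaf_list_sorted.
  by rewrite size_leaf_list /m /mm; lia.
pose f i : blk := (knum C1 (m i), l i).
have f1 i : (f i).1 < (f i.+1).1 by exact: knum_incr.
have f2 i : size (f i).2 = i.+1 by case: (hl i).
have f3 i : subblock C1 (f i) by exists (m i) => //; case: (hl i).
have [C2 C21 hC2] := R1_of_blocks f1 f2 f3.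
exists C2 => //.
have kle i j : i <= j -> knum C1 i <= knum C1 j.
  by rewrite leq_eqVlt => /predU1P[->//|/(knum_incr C1)/ltnW].
(* A continuation chosen at [cc i] starts after all earlier blocks of [C2] and ends before block
   [i]. *)
have gap i q r (d : blk) j : extends_to (cc i) (g (cc i)) r q -> d \in q ->
    d.1 <> knum C2 j.
  move=> [_ _ _ _ [q1 q2]] dq; rewrite (hC2 j).1 /= => e.
  have d1 := q1 _ dq; have d2 : d.1 < knum C1 (g (cc i)).
    by apply: (allP q2); rewrite mem_cat dq orbT.
  have [ij|ij] := leqP i j.
    have : knum C1 (g (cc i)) <= knum C1 (m j).
      apply: kle; apply: leq_trans (m_ge i) _.
      have := cc_mono i.+1 j.+1; rewrite !ccS; exact.
    by rewrite -e leqNgt d2.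
  have : knum C1 (m j) < knum C1 (cc i).
    by apply: knum_incr; have := cc_mono j.+1 i ij; rewrite ccS.
  by rewrite -e ltnNge d1.
have avoid_ext i r q : extends_to (cc i) (g (cc i)) r q -> avoid C2 r -> avoid C2 (r ++ q).
  move=> hq av c j; have [_ _ _ [_ e] _] := hq.
  rewrite mem_cat => /orP[cr|cq] ej; last by case: (gap _ _ _ _ j hq cq).
  by have [d dr hd] := av c j cr ej; exists d => //; rewrite e.
(* [r] imitates [s]: a block added at a constant approximation is skipped, any other is copied after
   a continuation. The index [i] bounds [r] and stays below every block of [C2] that can still be
   needed. *)
have main s : is_approx C s -> live F s -> (forall d, d \in canon_blocks s -> subblock C2 d) ->
    exists r i, [/\ is_approx C1 r, live F r, mix r s /\ canon_blocks r = canon_blocks s,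
      below (knum C1 (cc i)) r /\ (forall k, below k s -> forall j, k = knum C2 j -> i <= j)
      & avoid C2 r].
  elim/last_ind: s => [|s b IH].
    move=> _ _ _; exists [::], 0; split=> //; split=> //; exact: refl.
  move=> /[dup] apsb /is_approx_rcons[aps bC sb bs] /[dup] lsb /live_rcons[ls nFs] hpl.
  have [d ds|r [i [apr lr [mrs plr] [br hi] av]]] := IH aps ls.
    by apply: hpl; rewrite canon_blocks_rcons mem_cat ds.
  have [cs|cs] := pselect (const_next s).
    exists r, i; split=> //; rewrite ?canon_blocks_rcons_const_next //; split=> //.
      apply: mix_trans mrs _ => //; apply: sym; apply/gen_rcons => //.
      by split=> //; exact: refl.
    by move=> k; rewrite below_rcons => /andP[_]; exact: hi.
  have : subblock C2 (b.1, sel b.2 (read_positions s)).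
    by apply: hpl; rewrite canon_blocks_rcons_nonconst // mem_rcons mem_head.
  case=> j /= bj wj.
  have ij : i <= j by apply: hi bs _ bj.
  have br' : below (knum C1 (cc j)) r by apply: below_leq br; apply: kle; exact: cc_mono.
  have [q hq] := (hg (cc j)).2 r apr lr br'.
  have [apq lq Fq [mq plq] [q1 q2]] := hq.
  have mqs : mix (r ++ q) s by exact: (mix_trans HW Etrans mq mrs).
  (* A member of [F] mixes only with constant approximations outside [F], and [s] is not
     constant. *)
  have nFq : ~ F (r ++ q).
    by move=> Frq; apply: cs; apply: (mix_F_const_next HW Esym Etrans mqs).
  have cq : ~ const_next (r ++ q) by case: Fq.
  (* The leaves read from [b] are placed at the read positions of [r ++ q], all other new leaves
     outside [C2]. The counts match because mixing nonconstant approximations read equally many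
     positions. *)
  have [_ _ /(_ (sel b.2 (read_positions s)) (read_positions (r ++ q)) (size (r ++ q)).+1)] := hl j.
  case.
  - by rewrite ltnS; exact: is_approx_size_le apq q2.
  - exact: read_positionsP.
  - by rewrite (hC2 j).2 in wj.
  - rewrite size_sel; apply: mix_size_read_positions => //; first exact: sym.
      exact: is_approx_le CA aps.
    by apply: is_approx_le apq; exact: leR1_trans CA.
  move=> v [vl sv ev av'].
  have kj : knum C2 j = knum C1 (m j) by rewrite (hC2 j).1.
  have apv : is_approx C1 (rcons (r ++ q) (b.1, v)).
    apply/is_approx_rcons; split=> //; first by exists (m j); rewrite //= bj kj.
    by rewrite /= bj kj; apply: below_leq q2; exact: kle.
  have lv' : live F (rcons (r ++ q) (b.1, v)) by apply/live_rcons.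
  exists (rcons (r ++ q) (b.1, v)), j.+1; split=> //.
  - split; last by rewrite !canon_blocks_rcons_nonconst // plq plr ev.
    apply/gen_rcons2 => //; first exact: is_approx_le C1C _.
    by split=> //; right; split.
  - split.
      rewrite ccS below_rcons /= bj kj knum_incr //=.
      by apply: below_leq q2; apply: kle; apply: leqW.
    move=> k; rewrite below_rcons => /andP[bk _] j' ek.
    by apply: (@knum_lt C2); rewrite -bj -ek.
  - move=> c j'; rewrite mem_rcons inE => /predU1P[->|cr] ej'.
      exists (b.1, sel b.2 (read_positions s)).
        by rewrite canon_blocks_rcons_nonconst // ev mem_rcons mem_head.
      split=> //= x xv; have -> : j' = j by apply: (@knum_inj C2); rewrite -bj -ej'.
      rewrite (hC2 j).2; exact: av'.
    have [d dr hd] := avoid_ext _ _ _ hq av c j' cr ej'; exists d => //.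
    by rewrite canon_blocks_rcons mem_cat dr.
move=> a apa Fa hpl.
have la : live F a by apply: hF.2 => //; exact: is_approx_le CA _.
have [r [i [apr lr [mra plr] [br _] av]]] := main a apa la hpl.
have [q hq] := (hg (cc i)).2 r apr lr br.
have [apq lq Fq [mq plq] _] := hq.
exists (r ++ q); split=> //; last 2 first.
- by rewrite plq.
- exact: avoid_ext hq av.
(* Outside [F] the continuation would be nonconstant, yet it mixes with [a], which belongs to
   [F]. *)
apply: contrapT => nFq; case: Fq => // cq; apply: cq.
apply: (@mix_F_const_next _ _ _ _ HW Esym Etrans a) => //.
by apply: sym; exact: (mix_trans HW Etrans mq mra).
Qed.

End Generic.

End Canon.

(** * From lists of blocks to sets of nodes *)

Definition nodes (s : seq blk) : set node :=
  [set x | exists2 b : blk, b \in s &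
     x = [:: b.1] \/ exists2 i, i \in b.2 & x = [:: b.1; i]].

(** [approx 0 X] is the empty set, so the root is present for nonempty lists only. *)
Definition root_of (s : seq blk) : set node := [set x | x = [::] /\ s <> [::]].

Definition node_set (s : seq blk) : set node := root_of s `|` nodes s.

Definition block_sorted (s : seq blk) : Prop :=
  sorted ltn (unzip1 s) /\ forall b : blk, b \in s -> sorted ltn b.2.

Lemma is_approx_block_sorted X s : is_approx X s -> block_sorted s.
Proof. by case=> h _ H; split=> // b /H; exact: subblock_sorted. Qed.

Lemma block_sorted_key s (b c : blk) : block_sorted s -> b \in s -> c \in s -> b.1 = c.1 -> b = c.
Proof.
move=> [h _] /(nthP (0, [::]))[i si <-] /(nthP (0, [::]))[j sj <-] e.
congr nth; apply: (sorted_nth_inj h); rewrite ?size_map //.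
by rewrite !(nth_map (0, [::])).
Qed.

Lemma nodes2P s (b : blk) i : block_sorted s -> b \in s -> nodes s [:: b.1; i] -> i \in b.2.
Proof.
by move=> hs bs [c cs [//|[j jc [e ->]]]]; rewrite (block_sorted_key hs bs cs e).
Qed.

Lemma nodes_mem s t b : block_sorted s -> block_sorted t -> nodes s = nodes t -> b \in s -> b \in t.
Proof.
move=> hs ht e bs.
have [c ct [[ec]|[//]]] : nodes t [:: b.1] by rewrite -e; exists b => //; left.
suff -> : b = c by [].
rewrite (surjective_pairing b) (surjective_pairing c) ec; congr pair.
apply: (irr_sorted_eq ltn_trans ltnn); [exact: hs.2|exact: ht.2|] => i.
apply/idP/idP => ib.
  apply: (nodes2P ht ct); rewrite -ec -e; exists b => //; right; by exists i.
apply: (nodes2P hs bs); rewrite ec e; exists c => //; right; by exists i.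
Qed.

Lemma nodes_inj s t : block_sorted s -> block_sorted t -> nodes s = nodes t -> s = t.
Proof.
move=> hs ht e.
apply: (@irr_sorted_eq _ (fun b c : blk => b.1 < c.1)).
- by move=> b a c; exact: ltn_trans.
- by move=> b; exact: ltnn.
- by have := hs.1; rewrite /unzip1 sorted_map.
- by have := ht.1; rewrite /unzip1 sorted_map.
- by move=> b; apply/idP/idP; apply: nodes_mem.
Qed.

Lemma nodes_root s : ~ nodes s [::].
Proof. by case=> b _ [|[]]. Qed.

Lemma root_nodes_eq s t u v : root_of u `|` nodes s = root_of v `|` nodes t ->
  nodes s = nodes t.
Proof.
move=> e; apply/seteqP; split=> x hx; have nx : x <> [::] by move=> ex; rewrite ex in hx; exact: nodes_root hx.
  by have : (root_of v `|` nodes t) x; [rewrite -e; right | case=> [[]|]].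
by have : (root_of u `|` nodes s) x; [rewrite e; right | case=> [[]|]].
Qed.

Lemma node_set_inj s t : block_sorted s -> block_sorted t -> node_set s = node_set t -> s = t.
Proof. by move=> hs ht /root_nodes_eq; exact: nodes_inj. Qed.

Lemma approx_node_set n Y : approx n Y = node_set (approx_list Y n).
Proof.
apply/seteqP; split=> x.
  case=> i /= iN hx.
  have bi : (knum Y i, leaf_list Y i) \in approx_list Y n by apply/mapP; exists i; rewrite ?mem_iota.
  case: hx => [->|->|[j jL ->]].
  - by left; split=> // e; rewrite e in bi.
  - by right; exists (knum Y i, leaf_list Y i) => //; left.
  - by right; exists (knum Y i, leaf_list Y i) => //; right; exists j => //; rewrite mem_leaf_list.
case=> [[-> ne]|[b /mapP[i]]].
  case: n ne => [//|n] _; exists 0 => //; exact: Or31.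
rewrite mem_iota => /andP[_ iN] ->; case=> [->|[j jL ->]].
  by exists i => //; exact: Or32.
by exists i => //; apply: Or33; exists j => //; rewrite -mem_leaf_list.
Qed.

Lemma is_approx_tree X s : is_approx X s -> node_set s `<=` tree X.
Proof.
move=> [_ _ h] x [[-> _]|[b /h[m e sub]]]; first by left.
rewrite e => -[->|[i ib ->]]; first by apply/tree1P; exists m.
by apply/tree2P; rewrite -mem_leaf_list; exact: (mem_subseq sub).
Qed.

Lemma tree_is_approx X Y s : is_approx Y s -> node_set s `<=` tree X -> is_approx X s.
Proof.
move=> [h1 h2 h3] sub; split=> // b bs.
have /tree1P[m e] : tree X [:: b.1] by apply: sub; right; exists b => //; left.
exists m => //; apply: subset_subseq; [exact: subblock_sorted (h3 _ bs)|exact: leaf_list_sorted|].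
move=> i ib; rewrite mem_leaf_list; apply/tree2P; rewrite -e; apply: sub; right.
by exists b => //; right; exists i.
Qed.

Lemma restr_node_set F C a : F `<=` AR -> restr F C a -> exists2 s, is_approx C s & a = node_set s.
Proof.
move=> FAR [/FAR[X [n ->]] sub]; exists (approx_list X n); last exact: approx_node_set.
by apply: (@tree_is_approx _ X); [exact: is_approx_approx_list | rewrite -approx_node_set].
Qed.

Lemma is_approx_extend A s : is_approx A s -> exists2 Y, leR1 Y A & approx_list Y (size s) = s.
Proof.
move=> aps; have [K sK] := below_ex s; have [h1 h2 h3] := aps.
(* Beyond [s], blocks of [A] from index [K] on have numbers above those of [s], and index [K + i]
   offers at least [i.+1] leaves. *)
pose f i : blk := if i < size s then nth (0, [::]) s i else
  (knum A (K + i), take i.+1 (leaf_list A (K + i))).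
have f1 i : (f i).1 < (f i.+1).1.
  rewrite /f; case: (ltnP i.+1 (size s)) => hi.
    rewrite (ltnW hi); have := @sorted_nth_ltn _ i i.+1 h1; rewrite size_map ltnSn hi => /(_ isT).
    by rewrite !(nth_map (0, [::])) // ltnW.
  case: (ltnP i (size s)) => hi' /=; last by apply: knum_incr; rewrite ltn_add2l.
  have h : (nth (0, [::]) s i).1 < K by apply: (allP sK); exact: mem_nth.
  apply: leq_trans h _; apply: leq_trans (knum_ge _ _); exact: leq_addr.
have f2 i : size (f i).2 = i.+1.
  rewrite /f; case: ltnP => hi /=; last by rewrite size_takel // size_leaf_list ltnS leq_addl.
  have := congr1 (fun r => nth 0 r i) h2.
  by rewrite (nth_map (0, [::])) // nth_iota.
have f3 i : subblock A (f i).
  rewrite /f; case: ltnP => hi; first by apply: h3; exact: mem_nth.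
  by exists (K + i) => //; exact: take_subseq.
have [Y YA hY] := R1_of_blocks f1 f2 f3; exists Y => //.
apply: (@eq_from_nth _ (0, [::])); rewrite size_approx_list // => i si.
rewrite (nth_map 0) ?size_iota // nth_iota // add0n.
have [-> ->] := hY i.
by rewrite -surjective_pairing /f si.
Qed.

Lemma approx_list_take Y n m : m <= n -> approx_list Y m = take m (approx_list Y n).
Proof. by move=> mn; rewrite /approx_list -map_take take_iota (minn_idPl mn). Qed.

Lemma front_lfront A F : front A F -> lfront A (fun s => F (node_set s)).
Proof.
move=> [FAR cov anti]; split=> [Y YA|s aps Fs n ns Fn].
  by have [a Fa [m e]] := cov Y YA; exists m; rewrite -approx_node_set -e.
have [Y _ eY] := is_approx_extend aps.
have en : approx_list Y n = take n s by rewrite -[in RHS]eY -approx_list_take // ltnW.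
apply: (anti _ _ Fn Fs).
  move=> /node_set_inj e; have := congr1 size (e (is_approx_block_sorted (is_approx_take n aps)) (is_approx_block_sorted aps)).
  by rewrite (size_takel (ltnW ns)) => h; move: ns; rewrite h ltnn.
exists Y, n, (size s); split; first exact: ltnW.
  by rewrite approx_node_set en.
by rewrite approx_node_set eY.
Qed.

(** * Descent along finite sets of nodes *)

Definition node_list (s : seq blk) : seq node :=
  flatten [seq [:: b.1] :: [seq [:: b.1; i] | i <- b.2] | b : blk <- s].

Lemma node_listP s x : nodes s x <-> x \in node_list s.
Proof.
split.
  move=> [b bs h]; apply/flatten_mapP; exists b => //; rewrite inE.
  by case: h => [->|[i ib ->]]; [rewrite eqxx | rewrite (map_f (fun i => [:: b.1; i])) ?orbT].
move=> /flatten_mapP[b bs]; rewrite inE => /predU1P[->|/mapP[i ib ->]].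
  by exists b => //; left.
by exists b => //; right; exists i.
Qed.

Lemma nodes_proper_size s t : nodes s `<` nodes t ->
  size (undup (node_list s)) < size (undup (node_list t)).
Proof.
move=> [st nts].
have [x tx nsx] : exists2 x, nodes t x & ~ nodes s x.
  apply: contrapT => h; apply: nts => x tx; apply: contrapT => nsx; apply: h.
  by exists x.
have -> : (size (undup (node_list s))).+1 = size (x :: undup (node_list s)) by [].
apply: uniq_leq_size.
  rewrite /= undup_uniq andbT mem_undup; apply/negP => /node_listP; exact: nsx.
move=> y; rewrite inE mem_undup => /predU1P[->|]; rewrite mem_undup.
  by apply/node_listP.
by move/node_listP/st/node_listP.
Qed.

Lemma no_descent (Q : seq blk -> Prop) (f : seq blk -> seq blk) s :
  Q s -> ~ (forall s, Q s -> exists2 t, Q t & nodes (f t) `<` nodes (f s)).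
Proof.
move=> Qs H; have [n] := ubnP (size (undup (node_list (f s)))).
elim: n s Qs => // n IH s Qs sn; have [t Qt ts] := H s Qs.
apply: (IH t Qt); exact: leq_trans (nodes_proper_size ts) sn.
Qed.

Theorem theorem4p14 (A : R1) (F : set (set node))
    (E : set node -> set node -> Prop)
    (hF : front A F) (hE : equivalence_on F E) :
  exists2 C : R1, leR1 C A & canonical_on C (restr F C) E.
Proof.
have [FAR _ _] := hF; have [Er Es Et] := hE.
have hFl := front_lfront hF.
pose Fl s := F (node_set s); pose El s t := E (node_set s) (node_set t).
have [W HW] := block_ultra_ex A.
have Erl s : is_approx A s -> Fl s -> El s s by move=> _; exact: Er.
have Esl s t : is_approx A s -> is_approx A t -> Fl s -> Fl t -> El s t -> El t s.
  by move=> _ _; exact: Es.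
have Etl s t r : is_approx A s -> is_approx A t -> is_approx A r -> Fl s -> Fl t -> Fl r ->
  El s t -> El t r -> El s r by move=> _ _ _; exact: Et.
have [C0 C0A gC0] := generic_ex HW hFl Erl Esl Etl.
pose P := canon_blocks A W Fl El.
(* [a] ranges over [C0], so that the property of [b] is fixed before [C1] is known; [transfer] can
   bring [a] back into [C1] later. *)
have [C1 C10 hC1] := @nash_williams C0 Fl
  (fun b => exists a, [/\ is_approx C0 a, Fl a & nodes (P a) `<` nodes (P b)]) (lfront_le C0A hFl).
have C1A := leR1_trans C10 C0A.
have [C2 C21 hC2] := transfer HW hFl Erl Esl Etl C0A gC0 C10.
have liveF C s : leR1 C A -> is_approx C s -> Fl s -> live Fl s.
  by move=> CA aps; apply: hFl.2; exact: is_approx_le CA aps.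
have plE s t : is_approx C0 s -> is_approx C0 t -> Fl s -> Fl t -> (El s t <-> P s = P t).
  move=> aps apt Fs Ft; rewrite -(mix_canon_blocks HW hFl Erl Esl C0A gC0 aps apt); last 2 first.
  - exact: (liveF _ _ C0A aps Fs).
  - exact: (liveF _ _ C0A apt Ft).
  by rewrite (mix_F El HW C0A aps apt Fs Ft).
have wfP C s : is_approx C s -> block_sorted (P s).
  move=> aps; split; first exact: canon_blocks_sorted aps.
  by move=> b /(canon_blocks_subblock aps); exact: subblock_sorted.
have good : forall a b, is_approx C1 a -> is_approx C1 b -> Fl a -> Fl b -> ~ nodes (P a) `<` nodes (P b).
  case: hC1 => hC1; last first.
    move=> a b apa apb Fa Fb ab; apply: (hC1 b apb Fb); exists a; split=> //.
    exact: is_approx_le C10 _.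
  (* In the bad case images inside [C2] would shrink forever: an image smaller than one in [C2]
     still lies in [C2], so [transfer] realises it by a member inside [C1], to which homogeneity
     applies again. *)
  pose Q b := [/\ is_approx C1 b, Fl b & forall d, d \in P b -> subblock C2 d].
  have [n Fn] := (lfront_le (leR1_trans C21 C1A) hFl).1 C2 (fun x h => h).
  exfalso; apply: (@no_descent Q P (approx_list C2 n)).
    split=> //; first exact: is_approx_le C21 (is_approx_approx_list _ _).
    by move=> d; apply: canon_blocks_subblock; exact: is_approx_approx_list.
  move=> b [apb Fb hb]; have [a [apa Fa ab]] := hC1 b apb Fb.
  have ha d : d \in P a -> subblock C2 d.
    move=> dP.
    have [c cP [[ec]|[]//]] : nodes (P b) [:: d.1].
      by apply: ab.1; exists d => //; left.
    rewrite (surjective_pairing d) ec; apply: subblock_sub; first exact: hb cP.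
    apply: subset_subseq; [exact: (wfP _ _ apa).2 dP|exact: (wfP _ _ apb).2 cP|].
    move=> i id; apply: (nodes2P (wfP _ _ apb) cP); rewrite -ec; apply: ab.1.
    by exists d => //; right; exists i.
  have [b' [apb' Fb' eb' _]] := hC2 a apa Fa ha.
  exists b'; last by rewrite /P eb'.
  by split=> // d; rewrite /P eb'; exact: ha.
(* The root belongs to the image even if [P s] is empty: a competing map may take the value
   consisting of the root alone, and this value must be included. *)
pose nd s := root_of s `|` nodes (P s).
pose phi (a : set node) : set node := [set x | exists s, [/\ is_approx A s, a = node_set s & nd s x]].
have phiE C s : leR1 C A -> is_approx C s -> phi (node_set s) = nd s.
  move=> CA /(is_approx_le CA) aps; apply/seteqP; split=> x; last by move=> h; exists s.
  by move=> [t [apt /node_set_inj -> //]]; exact: is_approx_block_sorted (_ : is_approx A _).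
(* A front that contains the empty approximation has no other member, so the root never separates
   two members. *)
have nilF s t : is_approx A s -> is_approx A t -> Fl s -> Fl t -> s = [::] -> t = [::].
  move=> aps apt Fs Ft es; apply: contrapT => nt.
  have := hFl.2 t apt Ft 0; rewrite take0 -es; apply=> //.
  by case: t nt {apt Ft}.
exists C1 => //; exists phi; split.
- move=> _ /(restr_node_set FAR)[s aps ->].
  rewrite (phiE C1) //; split=> [x [[h1 h2]|[d dP h]]|x y xy].
  + by left.
  + have [b bs [e sub]] := canon_blocks_sub aps dP.
    right; exists b => //; rewrite -e; case: h => [->|[i id ->]]; [by left|right].
    by exists i => //; exact: (mem_subseq sub).
  case=> [[ey ns]|[d dP h]].
    by left; split=> //; move: xy; rewrite ey; case: x.
  case: x xy => [|k x] xy.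
    by left; split=> // es; rewrite es in dP.
  right; exists d => //; case: h => [ey|[i id ey]]; rewrite {}ey prefix_cons in xy.
    by move: xy; rewrite prefixs0 => /andP[/eqP -> /eqP ->]; left.
  case: x xy => [|j x]; first by rewrite prefix0s andbT => /eqP ->; left.
  by rewrite prefix_cons prefixs0 => /and3P[/eqP -> /eqP -> /eqP ->]; right; exists i.
- move=> a b ha hb; have [s aps es] := restr_node_set FAR ha.
  have [t apt et] := restr_node_set FAR hb; case: ha hb => [Fs _] [Ft _].
  rewrite es in Fs *; rewrite et in Ft *.
  rewrite !(phiE C1) // => -[st nts]; apply: (good s t aps apt Fs Ft); split.
    move=> x hx; have [[ex _]|//] := st x (or_intror hx).
    by rewrite ex in hx; case: (nodes_root hx).
  move=> ts; apply: nts => x [[-> nt]|/ts h]; [left|by right].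
  by split=> // s0; apply: nt; apply: (nilF s t) => //; exact: is_approx_le C1A _.
- move=> a b ha hb; have [s aps es] := restr_node_set FAR ha.
  have [t apt et] := restr_node_set FAR hb; case: ha hb => [Fs _] [Ft _].
  rewrite es in Fs *; rewrite et in Ft *.
  rewrite !(phiE C1) //.
  have h := plE s t (is_approx_le C10 aps) (is_approx_le C10 apt) Fs Ft.
  split=> [/h e|/root_nodes_eq /nodes_inj e]; last first.
    by apply/h; apply: e; [exact: wfP aps|exact: wfP apt].
  rewrite /nd e; congr setU; apply/seteqP; split=> x [-> nn]; split=> // ee; apply: nn;
    [apply: (nilF t s)|apply: (nilF s t)] => //; exact: is_approx_le C1A _.
- move=> phi' inn _ rep; exists C2 => // a [ha sub] x hx; have Fa := ha.1.
  have [s aps es] := restr_node_set FAR (conj Fa sub); subst a.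
  have aps1 := is_approx_le C21 aps; have C2A := leR1_trans C21 C1A.
  (* The partner [b] is equivalent to [s], so [phi'] takes the same value on both. Its nodes lie in
     [s], hence in [C2], and in [b], which apart from the root meets [C2] only in the common
     image. *)
  have [b [apb Fb eb av]] := hC2 s (is_approx_le C10 aps1) Fa (fun d => canon_blocks_subblock aps).
  have hb : restr F C1 (node_set b) by split=> //; exact: is_approx_tree.
  have e : phi' (node_set s) = phi' (node_set b).
    apply/rep => //; apply: (plE _ _ _ _ _ _).2 => //; first exact: is_approx_le C10 _.
    exact: is_approx_le C10 _.
  have hxb : node_set b x by apply: (inn _ hb).1; rewrite -e.
  have has : node_set s x by apply: (inn _ ha).1.
  rewrite (phiE C2) //; case: has => [|has]; first by left.
  right; case: hxb => [[ex _]|[c cb hc]]; first by rewrite ex in has; case: (nodes_root has).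
  have tx : tree C2 x by apply: sub; right.
  have [m em] : exists m, c.1 = knum C2 m.
    case: hc tx => [->|[i ic ->]]; first by move/tree1P.
    by case=> [//|[m _ [//|[j _ [ej _]]]]]; exists m.
  have [d db [ed hd]] := av c m cb em; rewrite eb in db.
  exists d => //; rewrite ed; case: hc tx => [->|[i ic ->]] tx; first by left.
  right; exists i => //; apply: hd => //; rewrite mem_leaf_list; apply/tree2P.
  by rewrite -em.
Qed.
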